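(* There exists a bounded domain $D\subseteq\mathbb R^2$ such that its boundary is $C^1$-smooth, $1_D\in\bigcap_{p>1}A_p(\mathbb R^2)$, and the boundary of $D$ does not contain (nondegenerate) straight line intervals.
   Context: A domain is a (nonempty) open connected set. $1_D$ denotes the characteristic function of $D$. The Fourier transform is $\widehat f(\xi)=\int_{\mathbb R^n} f(t)e^{-i(\xi,t)}\,dt$ for integrable $f$, where $(\cdot,\cdot)$ is the inner product in $\mathbb R^n$, and is extended to tempered distributions as usual. For $1\leq p\leq\infty$, $A_p(\mathbb R^n)$ is the space of tempered distributions $f$ on $\mathbb R^n$ such that $\widehat f\in L^p(\mathbb R^n)$, with norm $\|f\|_{A_p(\mathbb R^n)}=\|\widehat f\|_{L^p(\mathbb R^n)}$. The boundary $\partial D$ is $C^1$-smooth if in an appropriate neighborhood of each of its points $\partial D$ is (after a suitable choice of orthonormal coordinates) the graph of a real function of class $C^1$, i.e. a function all of whose first-order partial derivatives are continuous. *)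

(* Defs.v *)
(* Measure-theoretic analysis over an arbitrary [R : realType] (MathComp-Analysis);
   the plane is [R * R], complex numbers are [R[i]]. *)
From HB Require Import structures.
From mathcomp Require Export all_boot all_order all_algebra.
From mathcomp Require Export all_classical all_reals all_analysis.
From mathcomp Require Export complex.

Set Implicit Arguments.
Unset Strict Implicit.
Unset Printing Implicit Defensive.

Import Order.TTheory GRing.Theory Num.Theory.
Import numFieldNormedType.Exports.

Local Open Scope classical_set_scope.
Local Open Scope ring_scope.
Local Open Scope complex_scope.

Notation ReC := (@complex.Re _).
Notation ImC := (@complex.Im _).
(* the modulus as an element of [R]; [`|z|] would be an element of [R[i]] *)
Notation absC := (@complex.ComplexField.Normc.normc _).

Section Plane.
Context {R : realType}.
Implicit Types (D : set (R * R)) (x y v w : R * R).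

Definition dot x y : R := x.1 * y.1 + x.2 * y.2.

Definition orthonormal v w := [/\ dot v v = 1, dot w w = 1 & dot v w = 0].

Definition boundary D : set (R * R) := closure D `\` D°.

Definition domain D := [/\ D !=set0, open D & connected D].

Definition C1_on (a b : R) (phi : R -> R) :=
  forall s, s \in `]a, b[ -> derivable phi s 1 /\ {for s, continuous (derive1 phi)}.

Definition C1_boundary D :=
  forall x, boundary D x ->
  exists U : set (R * R), nbhs x U /\
  exists e1 e2 : R * R, orthonormal e1 e2 /\
  exists (a b : R) (phi : R -> R), C1_on a b phi /\
    boundary D `&` U = [set s *: e1 + phi s *: e2 | s in `]a, b[].

Definition contains_segment (A : set (R * R)) :=
  exists x y, x <> y /\
    forall t : R, 0 <= t <= 1 -> A ((1 - t) *: x + t *: y).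

End Plane.

Section Fourier.
Context {R : realType}.
Implicit Types (f g phi psi : R * R -> R[i]) (u : (R * R -> R[i]) -> R[i]).

Local Notation leb2 := (@lebesgue_measure R \x @lebesgue_measure R)%E.

Definition cintegral f : R[i] :=
  Rintegral leb2 setT (ReC \o f) +i* Rintegral leb2 setT (ImC \o f).

Definition cmeasurable f :=
  @measurable_fun _ _ (measurableTypeR R * measurableTypeR R)%type R
    setT (ReC \o f) /\
  @measurable_fun _ _ (measurableTypeR R * measurableTypeR R)%type R
    setT (ImC \o f).

Definition in_Lp (p : \bar R) f :=
  cmeasurable f /\ (Lnorm leb2 p (fun x => (absC (f x))%:E) < +oo)%E.

Definition expi (theta : R) : R[i] := cos theta +i* sin theta.

Definition fourier f (xi : R * R) : R[i] :=
  cintegral (fun t => f t * expi (- dot xi t)).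

(* [true] is the second coordinate, [false] the first *)
Definition basis_vec (b : bool) : R * R := if b then (0, 1) else (1, 0).

Definition partial (b : bool) f : R * R -> R[i] := fun x =>
  'D_(basis_vec b) (ReC \o f) x +i* 'D_(basis_vec b) (ImC \o f) x.

Definition iter_partial (s : seq bool) f := foldr partial f s.

Definition smooth f := forall s : seq bool,
  let h := iter_partial s f in
  [/\ continuous (ReC \o h), continuous (ImC \o h) &
      forall b x, derivable (ReC \o h) x (basis_vec b) /\
                  derivable (ImC \o h) x (basis_vec b)].

(* sup of (1 + |x|)^N |(d^s f)(x)| over x and |s| <= N; here |x| is the max norm
   of [R * R], which is equivalent to the Euclidean one *)
Definition schwartz_norm (N : nat) f : \bar R :=
  ereal_sup [set y | exists s x, (size s <= N)%N /\
    y = ((1 + `|x|) ^+ N * absC (iter_partial s f x))%:E].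

Definition schwartz f :=
  smooth f /\ forall N : nat, (schwartz_norm N f < +oo)%E.

(* Distributions are functionals on all functions [R * R -> R[i]], of which only
   the values at Schwartz functions are ever used. *)
Definition tempered u :=
  (forall (c : R[i]) phi psi, schwartz phi -> schwartz psi ->
     u (fun x => c * phi x + psi x) = c * u phi + u psi) /\
  exists (N : nat) (C : R), forall phi, schwartz phi ->
     ((absC (u phi))%:E <= C%:E * schwartz_norm N phi)%E.

Definition regular f phi : R[i] := cintegral (fun x => f x * phi x).

Definition dfourier u phi : R[i] := u (fourier phi).

Definition in_A (p : \bar R) u :=
  tempered u /\
  exists g, in_Lp p g /\
    forall phi, schwartz phi -> dfourier u phi = regular g phi.

Definition cindic (D : set (R * R)) : R * R -> R[i] := fun x => (\1_D x)%:C.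

End Fourier.

(* Main.v *)
(** The domain is [f x + f y < f 0 + f 1] for an even, strictly convex function [f]
    of class C^1: a level curve of a strictly convex function contains no segment,
    and this one is C^1 because [f'] vanishes only at 0.  The function [f] is a limit
    of piecewise linear convex functions.  Step [n] splits every kink into three
    kinks at mutual distance [gap n = 1 / (4^n n!)], which makes [f'] continuous in
    the limit, and adds two kinks of mass [gap n] at the points [+- site n], which
    makes [f'] strictly increasing since the sites are dense in [[0, 1]].

    The gaps decrease factorially while the number of kinks grows geometrically, so
    the boundary stays within [O(3^n gap n)] of a curve with [O(9^n)] edges.
    Integrating first in the second variable, the Fourier transform at [(a, b)]
    is [1/b] times oscillatory integrals along the boundary, in which an edge of
    slope [s] contributes [O(min(1, 1 / |a + s b|))].  For the least [n] such that the
    approximation error is negligible at frequency [b], the number of edges is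
    [O(|b|^e)] for every [e > 0]; hence the integral over [|a| <= |b|] of the [p]-th
    power of the transform is [O(|b|^(-q))] for every [q < p], in particular for some
    [q > 1].  The symmetry [x <-> y] takes care of [|b| <= |a|]. *)

Require Import Defs.
From HB Require Import structures.
From mathcomp Require Import ring lra zify measurable_realfun ess_sup_inf.

Set Implicit Arguments.
Unset Strict Implicit.
Unset Printing Implicit Defensive.

Import Order.TTheory GRing.Theory Num.Theory.
Import numFieldNormedType.Exports.

Local Open Scope classical_set_scope.
Local Open Scope ring_scope.

(** * The convex profile *)

Section Construction.
Context {R : realType}.
Implicit Types (x y : R) (n m k l : nat).

(** Where a boundary is smooth and curved, the transform decays only like [|xi|^(-3/2)] in the
    normal directions, which gives L^p just for p > 4/3. A polygon is in [A_p] for all p > 1 but has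
    corners and edges. So at each frequency the boundary must be close to a polygon with few edges,
    and corners and edges may disappear only in the limit. Edges are summed by absolute value,
    without cancellation: N edges cost a factor N^(p+1) in the p-th power of the transform, which is
    harmless since N grows more slowly than any power of the frequency. The factor 4^n in the gap
    has two uses. First, [4 * gap n.+1 <= gap n] keeps the sum of all later displacements below 2 *
    [gap n]. Second, it absorbs a factor 3^n: to the right of 0 the slopes of the n-th profile are
    only bounded below by 3^(-n), and an error in the profile is divided by such a slope when it
    becomes an error in the boundary. What remains is 1 / n!, small enough against the 9^n edges. *)

Definition gap n : R := (4 ^+ n * n`!%:R)^-1.

(** An explicit enumeration by prime exponents: a / b with 0 <= a < b is the value at n = 2^a
    3^(b-a-1) m for every m coprime to 6, so each such rational occurs infinitely often. *)
Definition site n : R := (logn 2 n)%:R / (logn 2 n + logn 3 n).+1%:R.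

Definition spread (h : R -> R) (d x : R) : R := (h (x - d) + h x + h (x + d)) / 3.

(* With the value -1 at 0, every [pl_slope n] is constant on each set where the
   comparisons [b < x] with the kinks [b] are constant. *)
Definition sgn_left x : R := if x <= 0 then -1 else 1.

Fixpoint pl_profile n x : R := if n is n'.+1
  then spread (pl_profile n') (gap n') x + gap n' * (`|x - site n'| + `|x + site n'|)
  else `|x|.

(** The left derivative of [pl_profile n], given by its own recursion so that no derivative is ever
    taken at a kink. *)
Fixpoint pl_slope n x : R := if n is n'.+1
  then spread (pl_slope n') (gap n') x + gap n' * (sgn_left (x - site n') + sgn_left (x + site n'))
  else sgn_left x.

Lemma gap_gt0 n : 0 < gap n.
Proof. by rewrite invr_gt0 mulr_gt0 ?exprn_gt0 ?ltr0n ?fact_gt0. Qed.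

Lemma gap0 : gap 0 = 1.
Proof. by rewrite /gap expr0 fact0 mul1r invr1. Qed.

Lemma gapS n : 4 * gap n.+1 <= gap n.
Proof.
have -> : gap n = 4 * gap n.+1 * n.+1%:R.
  rewrite /gap exprS factS natrM.
  field.
  by rewrite pnatr_eq0 -lt0n fact_gt0 expf_neq0// addrC natr1 pnatr_eq0.
by rewrite ler_peMr ?ler1n // mulr_ge0 ?ler0n // ltW// gap_gt0.
Qed.

Lemma gap_le n : gap n <= (4 ^+ n)^-1.
Proof.
by rewrite /gap lef_pV2 ?posrE ?mulr_gt0 ?exprn_gt0 ?ltr0n ?fact_gt0//
  ler_peMr ?exprn_ge0// ler1n fact_gt0.
Qed.

Lemma site_ge0 n : 0 <= site n.
Proof. by rewrite divr_ge0. Qed.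

Lemma site_le1 n : site n <= 1.
Proof. by rewrite ler_pdivrMr ?ltr0n// mul1r ler_nat leqW// leq_addr. Qed.

Lemma sgn_left_subgrad x y : sgn_left x * (y - x) <= `|y| - `|x|.
Proof.
rewrite /sgn_left; have := ler_norm y; have := ler_norm (- y); rewrite normrN.
by case: (leP x 0) => hx; [rewrite (ler0_norm hx)|rewrite (gtr0_norm hx)]; lra.
Qed.

Lemma sgn_left_bound x : -1 <= sgn_left x <= 1.
Proof. by rewrite /sgn_left; case: ifP => _; lra. Qed.

Lemma pl_profile_subgrad n x y : pl_slope n x * (y - x) <= pl_profile n y - pl_profile n x.
Proof.
elim: n x y => [|n IH] x y; first exact: sgn_left_subgrad.
rewrite /= /spread; set d := gap n; set q := site n.
have := IH x y; have := IH (x - d) (y - d); have := IH (x + d) (y + d).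
have := ler_pM2l (gap_gt0 n); rewrite -/d => dM.
have := sgn_left_subgrad (x - q) (y - q); have := sgn_left_subgrad (x + q) (y + q).
rewrite -dM; set u := sgn_left (x + q); set v := sgn_left (x - q) => Hu.
rewrite -dM; clear dM; move: Hu.
have -> : (y + q) - (x + q) = y - x by ring.
have -> : (y - q) - (x - q) = y - x by ring.
have -> : (y + d) - (x + d) = y - x by ring.
have -> : (y - d) - (x - d) = y - x by ring.
by lra.
Qed.

Lemma pl_profile_even n x : pl_profile n (- x) = pl_profile n x.
Proof.
elim: n x => [|n IH] x /=; first by rewrite normrN.
rewrite /spread; set d := gap n; set q := site n.
have -> : - x - d = - (x + d) by ring.
have -> : - x + d = - (x - d) by ring.
have -> : - x - q = - (x + q) by ring.
have -> : - x + q = - (x - q) by ring.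
by rewrite !IH !normrN; ring.
Qed.

Lemma pl_slope_homo n x y : x <= y -> pl_slope n x <= pl_slope n y.
Proof.
rewrite le_eqVlt => /predU1P[->//|xy].
have := pl_profile_subgrad n x y; have := pl_profile_subgrad n y x => H1 H2.
suff : 0 <= (pl_slope n y - pl_slope n x) * (y - x) by rewrite pmulr_lge0 ?subr_gt0// subr_ge0.
lra.
Qed.

(** Step n adds at most [2 * gap n] to the slope. The reserve [3 * gap n] closes the induction,
    because [3 * gap n.+1 <= gap n]; the result is a Lipschitz constant 4 independent of n. *)
Lemma pl_slope_bound n x : `|pl_slope n x| <= 4 - 3 * gap n.
Proof.
rewrite ler_norml; elim: n x => [|n IH] x /=.
  by rewrite gap0; have := sgn_left_bound x; lra.
rewrite /spread; set d := gap n; set q := site n.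
have := IH x; have := IH (x - d); have := IH (x + d).
have := sgn_left_bound (x - q); have := sgn_left_bound (x + q).
have := gapS n; have := gap_gt0 n; rewrite -/d.
set u := sgn_left (x + q); set v := sgn_left (x - q); move=> d0 dS.
move=> /andP[u1 u2] /andP[v1 v2] /andP[A1 A2] /andP[B1 B2] /andP[C1 C2].
have W1 : d * (u + v) <= d * 2 by rewrite ler_pM2l//; lra.
have W2 : d * (-2) <= d * (u + v) by rewrite ler_pM2l//; lra.
apply/andP; split; lra.
Qed.

Lemma pl_profile_lip n x y : `|pl_profile n y - pl_profile n x| <= 4 * `|y - x|.
Proof.
have H1 := pl_profile_subgrad n x y; have := pl_profile_subgrad n y x.
rewrite -(opprB y x) mulrN => H2.
have bd z : `|pl_slope n z * (y - x)| <= 4 * `|y - x|.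
  rewrite normrM ler_wpM2r//; apply: le_trans (pl_slope_bound n z) _.
  by have := gap_gt0 n; lra.
have := bd x; have := bd y; rewrite !ler_norml => /andP[? ?] /andP[? ?].
by apply/andP; split; lra.
Qed.

(** Of the three copies averaged, the middle one keeps a third of the previous growth and the outer
    two together do not decrease to the right of 0. This quantitative lower bound allows solving for
    the second coordinate on the boundary. *)
Lemma pl_profile_slope_ge n x y : 0 <= x <= y ->
  (3 ^+ n)^-1 * (y - x) <= pl_profile n y - pl_profile n x.
Proof.
elim: n x y => [|n IH] x y /andP[x0 xy] /=.
  by rewrite expr0 invr1 mul1r !ger0_norm//; lra.
rewrite /spread; set d := gap n; set q := site n.
have d0 : 0 < d := gap_gt0 n.
have q0 : 0 <= q := site_ge0 n.
(* By evenness the left copy runs from [d - x] to [d - y]; its subgradient at [d - x] is at most the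
   one at [x + d], since x >= 0. *)
have H1 : 0 <= pl_profile n (y - d) - pl_profile n (x - d) + 
    (pl_profile n (y + d) - pl_profile n (x + d)).
  have := pl_profile_subgrad n (x + d) (y + d); have := pl_profile_subgrad n (d - x) (d - y).
  rewrite -(pl_profile_even n (y - d)) -(pl_profile_even n (x - d)) !opprB.
  have := @pl_slope_homo n (d - x) (x + d).
  have -> : (d - x <= x + d) by lra.
  by move=> /(_ isT); nra.
have H2 : 0 <= `|y - q| + `|y + q| - (`|x - q| + `|x + q|).
  have -> : `|x + q| = x + q by rewrite ger0_norm//; lra.
  have -> : `|y + q| = y + q by rewrite ger0_norm//; lra.
  have := ler_norm (y - q); have := ler_normB (y - q) (y - x).
  have -> : y - q - (y - x) = x - q by ring.
  by rewrite (ger0_norm (_ : 0 <= y - x)); lra.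
have H3 := IH x y; rewrite x0 xy in H3; have {}H3 := H3 isT.
rewrite exprS invfM; move: H3; set s := (3 ^+ n)^-1 * (y - x) => H3.
have -> : 3^-1 * (3 ^+ n)^-1 * (y - x) = s / 3 by rewrite /s; ring.
nra.
Qed.

Lemma pl_profileS_dist n x : `|pl_profile n.+1 x - pl_profile n x| <= gap n * (6 + 2 * `|x|).
Proof.
rewrite /= /spread; set d := gap n; set q := site n.
have d0 : 0 < d := gap_gt0 n.
have q0 : 0 <= q := site_ge0 n.
have q1 : q <= 1 := site_le1 n.
have := pl_profile_lip n x (x - d); have := pl_profile_lip n x (x + d).
have -> : x + d - x = d by ring.
have -> : x - d - x = - d by ring.
rewrite normrN (gtr0_norm d0).
have := ler_normB x q; have := ler_normD x q; rewrite (ger0_norm q0).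
have := normr_ge0 (x - q); have := normr_ge0 (x + q); have := normr_ge0 x.
move: (`|x|) (`|x - q|) (`|x + q|) => X U V X0 V0 U0 HV HU.
rewrite !ler_norml => /andP[a1 a2] /andP[b1 b2].
have W1 : 0 <= d * (U + V) by rewrite mulr_ge0 ?addr_ge0// ltW.
have W2 : d * (U + V) <= d * (2 * X + 2) by rewrite ler_pM2l//; lra.
have W3 : d * (2 * X + 2) = 2 * (d * X) + 2 * d by ring.
have -> : d * (6 + 2 * X) = 6 * d + 2 * (d * X) by ring.
have W4 : 0 <= d * X by rewrite mulr_ge0 // ltW.
apply/andP; split; lra.
Qed.

(** Bound for the growth of [pl_slope n] over length [3 * gap n]. With 32 in the numerator, the site
    jumps, at most [4 * gap n], cost an eighth of it, and 1/3 + 1/8 < 1/2 gives the halving. *)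
Definition osc n : R := 32 / 2 ^+ n.

Lemma osc_gt0 n : 0 < osc n.
Proof. by rewrite divr_gt0// exprn_gt0. Qed.

Lemma oscS n : osc n.+1 = osc n / 2.
Proof. by rewrite /osc exprS invfM; ring. Qed.

Lemma gap_osc n : 8 * 4 * gap n <= osc n.
Proof.
rewrite /osc -natrM ler_pM2l ?ltr0n//; apply: le_trans (gap_le n) _.
rewrite lef_pV2 ?posrE ?exprn_gt0//.
by rewrite lerXn2r ?nnegrE//; lra.
Qed.

(* The three shifted increments of length [gap n] are adjacent, so their sum
   telescopes: each spreading step divides the mass of a short interval by three. *)
Lemma pl_slope_osc n x : pl_slope n (x + 3 * gap n) - pl_slope n x <= osc n.
Proof.
elim: n x => [|n IH] x.
  rewrite /osc expr0 divr1 /=; have := sgn_left_bound x.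
  by have := sgn_left_bound (x + 3 * gap 0); lra.
apply: le_trans (_ : pl_slope n.+1 (x + gap n) - pl_slope n.+1 x <= _).
  by rewrite lerD2r pl_slope_homo// lerD2l; have := gapS n; have := gap_gt0 n.+1; lra.
rewrite /= /spread oscS; set d := gap n; set q := site n.
have := IH (x - d); rewrite -/d.
have -> : x - d + 3 * d = x + d + d by ring.
have -> : x + d - d = x by ring.
have := gap_osc n; rewrite -/d; have d0 : 0 < d := gap_gt0 n.
have := sgn_left_bound (x + d - q); have := sgn_left_bound (x + d + q).
have := sgn_left_bound (x - q); have := sgn_left_bound (x + q).
have := osc_gt0 n.
move: (sgn_left (x + d - q)) (sgn_left (x + d + q)) (sgn_left (x - q)) (sgn_left (x + q)).
move=> s1 s2 s3 s4 o0 /andP[s41 s42] /andP[s31 s32] /andP[s21 s22] /andP[s11 s12] Ho H.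
have W : d * (s1 + s2 - (s3 + s4)) <= d * 4 by rewrite ler_pM2l//; lra.
lra.
Qed.

(** The points averaged are within [3 * gap n] of x, so by monotonicity and [pl_slope_osc] the
    averaging has an effect of order [osc n]. As [osc] is summable, the slopes converge
    uniformly. *)
Lemma pl_slopeS_dist n x : `|pl_slope n.+1 x - pl_slope n x| <= 2 * osc n.
Proof.
rewrite /= /spread; set d := gap n; set q := site n.
have d0 : 0 < d := gap_gt0 n.
have := pl_slope_osc n x; have := pl_slope_osc n (x - d); rewrite -/d.
have := @pl_slope_homo n (x - d) x; have := @pl_slope_homo n x (x + d).
have := @pl_slope_homo n (x + d) (x + 3 * d); have := @pl_slope_homo n x (x - d + 3 * d).
have -> : x - d <= x by lra.
have -> : x <= x + d by lra.
have -> : x + d <= x + 3 * d by lra.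
have -> : x <= x - d + 3 * d by lra.
move=> /(_ isT) H1 /(_ isT) H2 /(_ isT) H3 /(_ isT) H4 H5 H6.
have := sgn_left_bound (x - q); have := sgn_left_bound (x + q); have := gap_osc n; rewrite -/d.
move: (sgn_left (x - q)) (sgn_left (x + q)) => s3 s4 Ho /andP[s41 s42] /andP[s31 s32].
have W1 : d * (s3 + s4) <= d * 2 by rewrite ler_pM2l//; lra.
have W2 : d * (-2) <= d * (s3 + s4) by rewrite ler_pM2l//; lra.
have := osc_gt0 n => o0.
by rewrite ler_norml; apply/andP; split; lra.
Qed.

Lemma sgn_left_homo x y : x <= y -> sgn_left x <= sgn_left y.
Proof. by rewrite /sgn_left; case: (leP x 0); case: (leP y 0); lra. Qed.

Lemma pl_slope_incrS n x y : x <= y ->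
  pl_slope n (y - gap n) - pl_slope n (x + gap n) <= pl_slope n.+1 y - pl_slope n.+1 x.
Proof.
move=> xy; rewrite /= /spread; set d := gap n; set q := site n.
have d0 : 0 < d := gap_gt0 n.
have := @pl_slope_homo n (y - d) y; have := @pl_slope_homo n y (y + d).
have := @pl_slope_homo n (x - d) x; have := @pl_slope_homo n x (x + d).
have -> : x - d <= x by lra.
have -> : x <= x + d by lra.
have -> : y - d <= y by lra.
have -> : y <= y + d by lra.
move=> /(_ isT) H1 /(_ isT) H2 /(_ isT) H3 /(_ isT) H4.
have := @sgn_left_homo (x - q) (y - q); have := @sgn_left_homo (x + q) (y + q).
rewrite !lerD2r => /(_ xy) + /(_ xy).
move: (sgn_left (x - q)) (sgn_left (x + q)) (sgn_left (y - q)) (sgn_left (y + q)).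
move=> s1 s2 s3 s4 h1 h2.
have : 0 <= d * (s3 + s4 - (s1 + s2)) by rewrite mulr_ge0 ?(ltW d0)//; lra.
lra.
Qed.

(** Later steps cannot destroy growth of the slope, only displace it: one step by [gap n], and
    [gap n + 2 * gap n.+1 <= 2 * gap n] bounds all displacements together. *)
Lemma pl_slope_incr n k x y : x + 4 * gap n <= y ->
  pl_slope n (y - 2 * gap n) - pl_slope n (x + 2 * gap n) <=
  pl_slope (n + k) y - pl_slope (n + k) x.
Proof.
have d1 := gap_gt0 n; elim: k n x y d1 => [|k IH] n x y d1 xy.
  rewrite addn0.
  have := @pl_slope_homo n (y - 2 * gap n) y; have := @pl_slope_homo n x (x + 2 * gap n).
  have -> : x <= x + 2 * gap n by lra.
  have -> : y - 2 * gap n <= y by lra.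
  by move=> /(_ isT) + /(_ isT); lra.
have dS := gapS n; have d0 := gap_gt0 n.+1.
rewrite addnS -addSn; apply: le_trans (IH n.+1 x y d0 _); last by lra.
apply: le_trans (pl_slope_incrS n _); last by lra.
rewrite lerB// pl_slope_homo//; lra.
Qed.

Lemma pl_slope_site_jump n x y : x <= site n < y \/ x <= - site n < y ->
  2 * gap n <= pl_slope n.+1 y - pl_slope n.+1 x.
Proof.
set q := site n; set d := gap n => qxy; rewrite /= /spread -/d -/q.
have d0 : 0 < d := gap_gt0 n.
have xy : x <= y by case: qxy => /andP[]; lra.
have := @pl_slope_homo n x y xy; have := @pl_slope_homo n (x - d) (y - d).
have := @pl_slope_homo n (x + d) (y + d); rewrite !lerD2r => /(_ xy) H1 /(_ xy) H2 H3.
have : d * 2 <= d * (sgn_left (y - q) + sgn_left (y + q) - (sgn_left (x - q) + sgn_left (x + q))).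
  rewrite ler_pM2l//.
  have := @sgn_left_homo (x - q) (y - q); have := @sgn_left_homo (x + q) (y + q).
  rewrite !lerD2r => /(_ xy) + /(_ xy); move: qxy; rewrite /sgn_left.
  by move=> [] /andP[]; case: (leP (x - q) 0); case: (leP (y - q) 0);
    case: (leP (x + q) 0); case: (leP (y + q) 0); lra.
lra.
Qed.


(* The exponent of 5 is free, so each value of [site] is taken at arbitrarily large indices. *)
Lemma site_dense x y N : 0 <= x -> x < y -> y <= 1 ->
  exists2 n, (N <= n)%N & x < site n < y.
Proof.
move=> x0 xy y1.
have [r] := rat_in_itvoo xy; rewrite in_itv /= => /andP[xr ry].
have r0 : (0 < r) by rewrite -(ltr0q R); lra.
have r1 : ratr r < 1 :> R by lra.
set a := `|numq r|%N; set b := `|denq r|%N.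
have aE : a%:Z = numq r by rewrite gez0_abs// ltW// numq_gt0.
have bE : b%:Z = denq r by rewrite gez0_abs// ltW// denq_gt0.
have rE : ratr r = a%:R / b%:R :> R.
  by rewrite /ratr -aE -bE.
have b0 : (0 < b)%N by rewrite -ltz_nat bE denq_gt0.
have ab : (a < b)%N.
  have b0' : 0 < b%:R :> R by rewrite ltr0n.
  by rewrite -(ltr_nat R) -[ltRHS]mul1r -ltr_pdivrMr// -rE.
(* The exponents a and b - a - 1 produce numerator a and, with the [.+1] in [site], denominator
   b. *)
exists (2 ^ a * 3 ^ (b - a).-1 * 5 ^ N)%N.
  rewrite (leq_trans (ltnW (@ltn_expl 5 N _)))// leq_pmull//.
  by rewrite muln_gt0 !expn_gt0.
rewrite /site !lognM ?muln_gt0 ?expn_gt0// !lognX !logn_prime//=.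
rewrite !muln0 !muln1 !addn0 !add0n.
have -> : (a + (b - a).-1).+1 = b by lia.
by rewrite -rE xr ry.
Qed.

End Construction.

(** * Affine pieces of the approximating profiles *)

Section Pieces.
Context {R : realType}.
Implicit Types (x y : R) (n m k : nat).

Fixpoint breaks n : seq R := if n is n'.+1
  then site n' :: - site n' :: breaks n' ++
    ([seq b - gap n' | b <- breaks n'] ++ [seq b + gap n' | b <- breaks n'])
  else [:: 0].

(** Index of the affine piece containing x. The strict comparison assigns a kink to the piece on its
    left, as the left derivative does. *)
Definition rank n x := count (fun b => b < x) (breaks n).

(** The successor counts pieces instead of kinks: k kinks become 3k + 2, so the number of pieces
    triples. *)
Lemma size_breaks n : (size (breaks n)).+1 = (2 * 3 ^ n)%N.
Proof.
elim: n => [//|n IH] /=; rewrite !size_cat !size_map expnS; lia.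
Qed.

Lemma rank_lt n x : (rank n x < 2 * 3 ^ n)%N.
Proof. by rewrite -size_breaks ltnS count_size. Qed.

Lemma breaks0 n : 0 \in breaks n.
Proof.
by elim: n => [|n IH] //=; rewrite ?mem_head// !inE mem_cat IH /= !orbT.
Qed.

Lemma rank_homo n x y : x <= y -> (rank n x <= rank n y)%N.
Proof. by move=> xy; apply: sub_count => b /= /lt_le_trans; exact. Qed.

Lemma sub_count_eq (T : eqType) (p q : pred T) (s : seq T) :
  subpred p q -> count p s = count q s -> {in s, p =1 q}.
Proof.
move=> pq; elim: s => [//|a s IH] /= e b.
have ple : (count p s <= count q s)%N by apply: sub_count.
have pa : (p a <= q a)%N by have := pq a; case: (p a) => // /(_ isT) ->.
rewrite inE => /predU1P[->|]; last by apply: IH; lia.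
by move: e pa; case: (p a); case: (q a) => //; lia.
Qed.

Lemma rank_eq_breaks n x y : rank n x = rank n y ->
  forall b, b \in breaks n -> (b < x) = (b < y).
Proof.
wlog xy : x y / x <= y => [H|].
  by have [/H//|/ltW/H {}H /esym/H {}H b /H] := leP x y.
by move=> /sub_count_eq; apply => b /= /lt_le_trans; exact.
Qed.

(** Each of the shifted profiles in the recursion sees the points x and y shifted by the gap, and
    the kinks shifted the opposite way are in the list, so the induction hypothesis applies to all
    three copies. *)
Lemma breaks_affine n x y : (forall b, b \in breaks n -> (b < x) = (b < y)) ->
  pl_slope n x = pl_slope n y /\ pl_profile n y - pl_profile n x = pl_slope n x * (y - x).
Proof.
elim: n x y => [|n IH] x y /=.
  move=> /(_ 0); rewrite mem_head => /(_ isT); rewrite /sgn_left.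
  case: (leP x 0) => hx; case: (leP y 0) => hy// _.
    by rewrite !ler0_norm//; split=> //; lra.
  by rewrite !gtr0_norm//; split=> //; lra.
move=> H; set d := gap n in H *; set q := site n in H *.
have Hs c : c = q \/ c = - q ->
    sgn_left (x - c) = sgn_left (y - c) /\ `|y - c| - `|x - c| = sgn_left (x - c) * (y - x).
  move=> hc; have : (c < x) = (c < y).
    by apply: H; rewrite !inE; case: hc => ->; rewrite eqxx ?orbT.
  rewrite /sgn_left !subr_le0; case: (leP x c) => hx; case: (leP y c) => hy // _.
    by rewrite !ler0_norm ?subr_le0//; split=> //; lra.
  by rewrite !gtr0_norm ?subr_gt0//; split=> //; lra.
have [a1 b1] := Hs q (or_introl erefl).
have [] := Hs (- q) (or_intror erefl); rewrite !opprK => a2 b2.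
have H0 b : b \in breaks n -> (b < x) = (b < y).
  by move=> hb; apply: H; rewrite !inE mem_cat hb !orbT.
have Hm b : b \in breaks n -> (b < x - d) = (b < y - d).
  move=> hb; rewrite !ltrBrDr; apply: H.
  by rewrite !inE !mem_cat (map_f (fun b => b + d)) ?orbT.
have Hp b : b \in breaks n -> (b < x + d) = (b < y + d).
  move=> hb; rewrite -!ltrBlDr; apply: H.
  by rewrite !inE !mem_cat (map_f (fun b => b - d)) ?orbT.
have [a3 b3] := IH _ _ H0; have [a4 b4] := IH _ _ Hm; have [a5 b5] := IH _ _ Hp.
have e1 : y - d - (x - d) = y - x by ring.
have e2 : y + d - (x + d) = y - x by ring.
rewrite e1 in b4; rewrite e2 in b5.
rewrite /spread a1 a2 a3 a4 a5; split => //.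
rewrite -a1 -a2 -a3 -a4 -a5.
transitivity ((pl_profile n (y - d) - pl_profile n (x - d) + (pl_profile n y - pl_profile n x) +
  (pl_profile n (y + d) - pl_profile n (x + d))) / 3 +
  d * (`|y - q| - `|x - q| + (`|y + q| - `|x + q|))); first by ring.
by rewrite b1 b2 b3 b4 b5; ring.
Qed.

Lemma rank_affine n x y : rank n x = rank n y ->
  pl_slope n x = pl_slope n y /\ pl_profile n y - pl_profile n x = pl_slope n x * (y - x).
Proof. by move=> /rank_eq_breaks/breaks_affine. Qed.

(** No piece crosses 0, the point where the height of the boundary turns from increasing to
    decreasing. *)
Lemma rank_sign n x y : rank n x = rank n y -> (0 < x) = (0 < y).
Proof. by move=> /rank_eq_breaks; apply; exact: breaks0. Qed.

End Pieces.

(** * The limit profile and its slope *)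

Section Limit.
Context {R : realType}.
Implicit Types (x y : R) (n m k : nat).

(** The numbers [u n - 2 * e n] increase, [u n + 2 * e n] decrease, and the former stay below the
    latter; the supremum of the lower ends lies in every bracket, which gives the rate along with
    the limit. *)
Lemma halving_limit (u e : nat -> R) :
  (forall n, 0 <= e n) -> (forall n, 2 * e n.+1 <= e n) ->
  (forall n, `|u n.+1 - u n| <= e n) ->
  exists l, forall n, `|l - u n| <= 2 * e n.
Proof.
move=> e0 eS uS.
have [vS wS] : (forall n, u n - 2 * e n <= u n.+1 - 2 * e n.+1) /\
    (forall n, u n.+1 + 2 * e n.+1 <= u n + 2 * e n).
  by split=> n; have := uS n; have := eS n; rewrite ler_norml => ? /andP[]; lra.
have vm n m : (n <= m)%N -> u n - 2 * e n <= u m - 2 * e m.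
  by move=> nm; apply: (@homo_leq _ (fun n => u n - 2 * e n) <=%R) => //;
     exact: le_trans.
have wm n m : (n <= m)%N -> u m + 2 * e m <= u n + 2 * e n.
  move=> nm; apply: (@homo_leq _ (fun n => u n + 2 * e n) (fun a b => b <= a)) => //.
  by move=> a b c; move=> /[swap]; exact: le_trans.
have vw n m : u n - 2 * e n <= u m + 2 * e m.
  have [nm|/ltnW mn] := leqP n m.
    by have := vm _ _ nm; have := e0 m; lra.
  by have := wm _ _ mn; have := e0 n; lra.
set S := range (fun n => u n - 2 * e n).
exists (sup S) => n.
have Sn : S (u n - 2 * e n) by exists n.
have ub m : ubound S (u m + 2 * e m) by move=> _ [k _ <-]; exact: vw.
have h1 : u n - 2 * e n <= sup S by apply: ub_le_sup => //; exists (u 0 + 2 * e 0).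
have h2 : sup S <= u n + 2 * e n by apply: ge_sup => //; exists (u n - 2 * e n).
by rewrite ler_norml; apply/andP; split; lra.
Qed.

Lemma osc_lt e : 0 < e -> exists n, osc n < e :> R.
Proof.
move=> e0; set N := Num.truncn (32 / e : R).
exists N.+1; rewrite /osc ltr_pdivrMr ?exprn_gt0// mulrC -ltr_pdivrMr//.
apply: lt_le_trans (truncnS_gt _) _.
by rewrite -natrX ler_nat ltnW// ltn_expl.
Qed.

Lemma osc_nonincr n k : osc (n + k) <= osc n :> R.
Proof.
elim: k => [|k IH]; first by rewrite addn0.
by rewrite addnS oscS; have := @osc_gt0 R (n + k); lra.
Qed.

(** Used to pass inequalities to the limit: they hold at level n up to a multiple of [osc n]. *)
Lemma osc_squeeze (a C : R) : 0 <= C -> (forall n, a <= C * osc n) -> a <= 0.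
Proof.
move=> C0 H; rewrite leNgt; apply/negP => a0.
have C1 : 0 < C + 1 by lra.
have [n] := @osc_lt (a / (C + 1)) (divr_gt0 a0 C1).
rewrite ltr_pdivlMr//; have := H n; have := @osc_gt0 R n; nra.
Qed.

Lemma pl_profile_limit x : exists l,
  forall n, `|l - pl_profile n x| <= 2 * (gap n * (6 + 2 * `|x|)).
Proof.
have x0 := normr_ge0 x; apply: halving_limit => [n|n|n]; last exact: pl_profileS_dist.
  by rewrite mulr_ge0 ?(ltW (gap_gt0 n))//; lra.
by rewrite mulrA ler_wpM2r//; have := @gapS R n; have := @gap_gt0 R n.+1; lra.
Qed.

Lemma pl_slope_limit x : exists l, forall n, `|l - pl_slope n x| <= 2 * (2 * osc n).
Proof.
apply: halving_limit => [n|n|n]; last exact: pl_slopeS_dist.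
  by have := @osc_gt0 R n; lra.
by rewrite oscS; have := @osc_gt0 R n; lra.
Qed.

Definition profile x : R := projT1 (cid (pl_profile_limit x)).
Definition slope x : R := projT1 (cid (pl_slope_limit x)).

Lemma profile_approx n x : `|profile x - pl_profile n x| <= (3 + `|x|) * (4 * gap n).
Proof. by have := projT2 (cid (pl_profile_limit x)) n; rewrite -/(profile x); lra. Qed.

Lemma slope_approx n x : `|slope x - pl_slope n x| <= 4 * osc n.
Proof. by have := projT2 (cid (pl_slope_limit x)) n; rewrite -/(slope x); lra. Qed.

Lemma profile_approx_osc n x : `|profile x - pl_profile n x| <= (3 + `|x|) * osc n.
Proof.
apply: le_trans (profile_approx n x) _; apply: ler_wpM2l.
  by have := normr_ge0 x; lra.
by have := @gap_osc R n; have := @gap_gt0 R n; lra.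
Qed.

Lemma profile_approx1 n x : `|x| <= 1 -> `|profile x - pl_profile n x| <= 16 * gap n.
Proof.
move=> x1; apply: le_trans (profile_approx n x) _.
by have := @gap_gt0 R n; nra.
Qed.

Lemma profile_subgrad x y : slope x * (y - x) <= profile y - profile x.
Proof.
rewrite -subr_le0; apply: (@osc_squeeze _ (4 * `|y - x| + (3 + `|y|) + (3 + `|x|))).
  by have := normr_ge0 (y - x); have := normr_ge0 x; have := normr_ge0 y; lra.
move=> n; have := profile_approx_osc n x; have := profile_approx_osc n y.
have := pl_profile_subgrad n x y.
have : `|(slope x - pl_slope n x) * (y - x)| <= 4 * osc n * `|y - x|.
  by rewrite normrM ler_wpM2r// slope_approx.
rewrite !ler_norml => /andP[? ?] ? /andP[? ?] /andP[? ?]; lra.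
Qed.

Lemma profile_even x : profile (- x) = profile x.
Proof.
suff H y : profile (- y) - profile y <= 0.
  by have := H x; have := H (- x); rewrite opprK; lra.
apply: (@osc_squeeze _ (2 * (3 + `|y|))) => [|n]; first by have := normr_ge0 y; lra.
have := profile_approx_osc n y; have := profile_approx_osc n (- y).
rewrite normrN pl_profile_even !ler_norml => /andP[? ?] /andP[? ?]; lra.
Qed.

Lemma slope_homo x y : x <= y -> slope x <= slope y.
Proof.
rewrite le_eqVlt => /predU1P[->//|xy].
have := profile_subgrad x y; have := profile_subgrad y x => H1 H2.
suff : 0 <= (slope y - slope x) * (y - x) by rewrite pmulr_lge0 ?subr_gt0// subr_ge0.
lra.
Qed.

Lemma slope_continuous : continuous slope.
Proof.
move=> x; apply/cvgrPdist_le => /= e e0.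
(* Nine times [osc n] is lost: four for approximating each of the two slopes, one for the
   oscillation at level n. *)
have e9 : 0 < e / 9 by rewrite divr_gt0.
have [n ne] := osc_lt e9; have d0 := @gap_gt0 R n.
near=> y.
have : `|x - y| <= 3 * gap n.
  near: y; have h : 0 < 3 * gap n :> R by lra.
  by have /cvgr_dist_le/(_ _ h) := @cvg_id _ (nbhs x).
have := slope_approx n x; have := slope_approx n y.
have := pl_slope_osc n x; have := pl_slope_osc n y.
have := @pl_slope_homo R n x y; have := @pl_slope_homo R n y x.
have := @pl_slope_homo R n x (y + 3 * gap n); have := @pl_slope_homo R n y (x + 3 * gap n).
rewrite !ler_norml; case: (leP x y) => xy.
  move=> H1 H2 _ /(_ isT) H3 H4 H5 /andP[? ?] /andP[? ?] /andP[? ?].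
  have {}H1 : pl_slope n y <= pl_slope n (x + 3 * gap n) by apply: H1; lra.
  by apply/andP; split; lra.
move=> H1 H2 /(_ (ltW xy)) H3 _ H4 H5 /andP[? ?] /andP[? ?] /andP[? ?].
have {}H2 : pl_slope n x <= pl_slope n (y + 3 * gap n) by apply: H2; lra.
by apply/andP; split; lra.
Unshelve. all: by end_near. Qed.

(** The jump created at step n lies in the interval shortened by [2 * gap n.+1] at both ends, so by
    [pl_slope_incr] it survives in full between x and y at all later levels and in the limit. *)
Lemma slope_lt_site n x y : (x + 4 * gap n.+1 <= y) ->
  (x + 2 * gap n.+1 <= site n < y - 2 * gap n.+1 \/
   x + 2 * gap n.+1 <= - site n < y - 2 * gap n.+1) -> slope x < slope y.
Proof.
move=> xy /pl_slope_site_jump jump; have d0 := @gap_gt0 R n.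
suff : slope x - slope y + 2 * gap n <= 0 by lra.
apply: (@osc_squeeze _ 8) => // k.
have := pl_slope_incr k xy; have := slope_approx (n.+1 + k) x; have := slope_approx (n.+1 + k) y.
have := @osc_nonincr k n.+1; rewrite addnC.
by rewrite !ler_norml => ? /andP[? ?] /andP[? ?]; lra.
Qed.

Lemma slope_lt x y : -1 <= x -> x < y -> y <= 1 -> slope x < slope y.
Proof.
move=> x1 xy y1.
(* The sites lie in [0, 1], so the interval is cut down to its nonnegative part, or reflected if
   there is none; in the latter case the kink at [- site n] is used. *)
have [a [b [a0 ab b1 abxy]]] : exists a b, [/\ 0 <= a, a < b, b <= 1 &
    x <= a /\ b <= y \/ x <= - b /\ - a <= y].
  have [y0|y0] := leP y 0.
    by exists (- y), (- x); split; [lra..|right; lra].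
  by exists (Num.max 0 x), y; split; rewrite ?le_max ?lexx ?gt_max ?y0 ?orbT//; left.
set t := (b - a) / 3.
have t0 : 0 < t by rewrite divr_gt0// subr_gt0.
have [N Nt] := osc_lt t0.
have [|||n Nn /andP[n1 n2]] := @site_dense R (a + t) (b - t) N; [rewrite /t; lra..|].
have dt : 2 * gap n.+1 <= t.
  have := @gapS R n; have := @gap_osc R n; have := @osc_nonincr N (n - N).
  by rewrite subnKC//; have := @gap_gt0 R n; lra.
by apply: (@slope_lt_site n); case: abxy => -[? ?]; [rewrite /t in t0 dt n1 n2 *; lra..|left|right];
  apply/andP; split; lra.
Qed.

End Limit.

(** * The body and its boundary *)

Section Geometry.
Context {R : realType}.
Implicit Types (x y s t : R) (z : R * R).

Local Notation f := (@profile R).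
Local Notation g := (@slope R).

(** The subgradients at x and at h + x enclose the difference quotient, and they have the same limit
    because [slope] is continuous. *)
Lemma profile_is_derive x : is_derive x 1 f (g x).
Proof.
have H : (fun h : R => h^-1 *: (f (h *: 1 + x) - f x)) @ 0^' --> g x.
  apply/cvgrPdist_le => e e0.
  have gx : \forall y \near x, `|g x - g y| <= e.
    by have /cvgr_dist_le/(_ _ e0) := @slope_continuous R x.
  have gh : \forall h \near 0^', `|g x - g (h + x)| <= e.
    apply: nbhs_dnbhs => /=.
    have : (fun h : R => h + x) @ (0 : R) --> 0 + x.
      by apply: cvgD; [exact: cvg_id|exact: cvg_cst].
    by rewrite add0r => /(_ _ gx).
  near=> h.
  have h0 : h != 0 by near: h; exact: nbhs_dnbhs_neq.
  have : `|g x - g (h + x)| <= e by near: h.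
  have := profile_subgrad x (h + x); have := profile_subgrad (h + x) x.
  rewrite [h *: 1]mulr1; have -> : h + x - x = h by ring.
  have -> : x - (h + x) = - h by ring.
  rewrite mulrN => H1 H2 H3.
  have -> : g x - h^-1 *: (f (h + x) - f x) = (g x * h - (f (h + x) - f x)) / h.
    by rewrite /GRing.scale /=; field.
  rewrite normrM normfV ler_pdivrMr ?normr_gt0//.
  apply: le_trans (_ : `|(g x - g (h + x)) * h| <= _); last first.
    by rewrite normrM ler_wpM2r.
  by rewrite -normrN -[leRHS]normrN !ger0_norm; lra.
apply: DeriveDef; first by apply/cvg_ex; exists (g x).
exact/cvg_lim.
Unshelve. all: by end_near. Qed.

Lemma profile_continuous : continuous f.
Proof.
move=> x; apply: differentiable_continuous; apply/derivable1_diffP.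
by have [] := profile_is_derive x.
Qed.

Lemma slope0 : g 0 = 0.
Proof.
have H : is_derive (0 : R) 1 (f \o -%R) (g (- 0) * -1).
  by apply: is_derive1_comp; first exact: profile_is_derive.
have e : f \o -%R = f by apply/funext => y /=; rewrite profile_even.
rewrite e in H; have := @derive_val _ _ _ _ _ _ _ H.
have := @derive_val _ _ _ _ _ _ _ (profile_is_derive 0).
by rewrite oppr0 => ->; lra.
Qed.

Lemma slope_gt0 x : 0 < x -> 0 < g x.
Proof.
move=> x0; have [x1|x1] := leP x 1.
  by rewrite -slope0 slope_lt//; lra.
apply: lt_le_trans (slope_homo (ltW x1)).
by rewrite -slope0 slope_lt//; lra.
Qed.

Lemma profile_lt x y : 0 <= x -> x < y -> f x < f y.
Proof.
move=> x0 xy; pose z := (x + y) / 2.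
have z0 : 0 < z by rewrite /z; lra.
have := profile_subgrad x z; have := profile_subgrad z y.
have := slope_gt0 z0; have := slope_homo x0; rewrite slope0 => gx gz h1 h2.
have : 0 < g z * (y - z) by rewrite mulr_gt0 // /z; lra.
have : 0 <= g x * (z - x) by rewrite mulr_ge0 // /z; lra.
lra.
Qed.

Lemma profile_le x y : 0 <= x -> x <= y -> f x <= f y.
Proof. by move=> x0; rewrite le_eqVlt => /predU1P[->//|/(profile_lt x0)/ltW]. Qed.

Lemma profile_norm x : f `|x| = f x.
Proof. by case: (ger0P x) => _ //; rewrite profile_even. Qed.

Lemma profile_ltE x y : (f x < f y) = (`|x| < `|y|).
Proof.
rewrite -[in LHS](profile_norm x) -[in LHS](profile_norm y).
case: (ltP `|x| `|y|) => [/profile_lt->//|yx].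
by apply/negbTE; rewrite -leNgt profile_le.
Qed.

Lemma profile_leE x y : (f x <= f y) = (`|x| <= `|y|).
Proof. by rewrite leNgt profile_ltE -leNgt. Qed.

(** Subgradients at m and at the midpoint of x and m are added; the slope at the midpoint differs
    strictly from that at m, in the right direction. *)
Lemma profile_strict x m : -1 <= x <= 1 -> -1 <= m <= 1 -> x != m ->
  f m + g m * (x - m) < f x.
Proof.
move=> /andP[x1 x2] /andP[m1 m2] xm; pose z := (x + m) / 2.
have := profile_subgrad m z; have := profile_subgrad z x.
have -> : x - z = (x - m) / 2 by rewrite /z; lra.
have -> : z - m = (x - m) / 2 by rewrite /z; lra.
have : 0 < (g z - g m) * (x - m).
  case: (ltgtP x m) xm => // h _.
    have : g z < g m by rewrite slope_lt// /z; lra.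
    by move=> ?; rewrite nmulr_lgt0; lra.
  have : g m < g z by rewrite slope_lt// /z; lra.
  by move=> ?; rewrite pmulr_lgt0; lra.
lra.
Qed.

(** This value makes the level curve pass through the four points at distance 1 on the axes, so that
    the body fits in the square [-1, 1]^2, where the slope is known to be strictly increasing. *)
Definition level : R := f 0 + f 1.
Definition body : set (R * R) := [set z | f z.1 + f z.2 < level].

Lemma sublevel_box z : f z.1 + f z.2 <= level -> `|z.1| <= 1 /\ `|z.2| <= 1.
Proof.
have f0 x : f 0 <= f x by rewrite -(profile_norm x) profile_le.
move=> H; have := f0 z.1; have := f0 z.2; rewrite /level in H => h1 h2.
have : f z.1 <= f 1 by lra.
have : f z.2 <= f 1 by lra.
by rewrite !profile_leE normr1.
Qed.

Lemma level_on_axis z : f z.1 + f z.2 = level -> z.2 = 0 -> z.1 = 1 \/ z.1 = -1.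
Proof.
move=> + z0; rewrite z0 /level addrC => /addrI e.
have : (f z.1 <= f 1) && (f 1 <= f z.1) by rewrite e lexx.
rewrite !profile_leE normr1 -eq_le => /eqP.
by case: (ler0P z.1) => _ h; [right; lra|left].
Qed.

Lemma plane_sum_continuous : continuous (fun z : R * R => f z.1 + f z.2).
Proof.
move=> z; apply: cvgD.
- by apply: (@continuous_comp _ _ _ fst f); [exact: cvg_fst|exact: profile_continuous].
- by apply: (@continuous_comp _ _ _ snd f); [exact: cvg_snd|exact: profile_continuous].
Qed.

Lemma body_open : open body.
Proof.
rewrite (_ : body = (fun z => f z.1 + f z.2) @^-1` [set y | y < level])//.
by apply: open_comp; [move=> z _; exact: plane_sum_continuous|exact: open_lt].
Qed.

Lemma profile_scale t x : 0 <= t <= 1 -> f (t * x) <= (1 - t) * f 0 + t * f x.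
Proof.
move=> /andP[t0 t1]; have := profile_subgrad (t * x) 0; have := profile_subgrad (t * x) x.
have -> : x - t * x = (1 - t) * x by ring.
have -> : 0 - t * x = - (t * x) by ring.
set a := g (t * x) => h1 h2.
have : t * (a * ((1 - t) * x)) <= t * (f x - f (t * x)) by rewrite ler_wpM2l.
have : (1 - t) * (a * - (t * x)) <= (1 - t) * (f 0 - f (t * x)).
  by rewrite ler_wpM2l//; lra.
have -> : (1 - t) * (a * - (t * x)) = - (t * (a * ((1 - t) * x))) by ring.
lra.
Qed.

Lemma plane_sum0 : f 0 + f 0 < level.
Proof. by rewrite /level ltrD2l profile_ltE normr0 normr1. Qed.

(** By convexity, shrinking towards the origin, where the sum is below the level, makes the
    inequality strict. This gives connectedness as well as the density of the body near its level
    curve. *)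
Lemma scale_sublevel z t : f z.1 + f z.2 <= level -> 0 <= t < 1 ->
  body (t *: z).
Proof.
move=> zl /andP[t0 t1]; rewrite /body /= /GRing.scale /=.
have t01 : 0 <= t <= 1 by lra.
have := profile_scale z.1 t01; have := profile_scale z.2 t01.
have := plane_sum0 => h0 h2 h1.
have H1 : (1 - t) * (f 0 + f 0) < (1 - t) * level by rewrite ltr_pM2l//; lra.
have H2 : t * (f z.1 + f z.2) <= t * level by rewrite ler_wpM2l.
lra.
Qed.

Lemma body_domain : domain body.
Proof.
split; [by exists (0, 0); exact: plane_sum0|exact: body_open|].
rewrite (_ : body = \bigcup_(z in body) ((fun t : R => t *: z) @` `[0, 1])).
  apply: bigcup_connected.
    by exists 0 => z _ /=; exists 0; rewrite ?scale0r// in_itv/= lexx ler01.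
  move=> z _; apply: connected_continuous_connected; first exact: segment_connected.
  by apply: continuous_subspaceT; exact: scalel_continuous.
apply/seteqP; split=> [z bz|y [z bz [t /=]]].
  by exists z => //; exists 1; rewrite ?scale1r// /= in_itv/= lexx ler01.
rewrite in_itv/= => /andP[t0 t1] <-; move: t1; rewrite le_eqVlt => /predU1P[->|t1].
  by rewrite scale1r.
by apply: scale_sublevel; [exact: ltW|rewrite t0].
Qed.

Lemma body_bounded : bounded_set body.
Proof.
exists 1; split=> // M M1 z /ltW/sublevel_box[h1 h2].
by rewrite /= prod_normE ge_max; apply/andP; split; lra.
Qed.

Lemma boundary_body : boundary body = [set z | f z.1 + f z.2 = level].
Proof.
rewrite /boundary; move/interior_id : body_open => ->.
have cl : closed [set z : R * R | f z.1 + f z.2 <= level].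
  rewrite (_ : mkset _ = (fun z => f z.1 + f z.2) @^-1` [set y | y <= level])//.
  by apply: closed_comp; [move=> z _; exact: plane_sum_continuous|exact: closed_le].
apply/seteqP; split=> z /=.
  move=> [cz /negP]; rewrite /body /= -leNgt => zl.
  have : f z.1 + f z.2 <= level.
    suff : [set z : R * R | f z.1 + f z.2 <= level] z by [].
    by rewrite ((closure_id _).1 cl); apply: closureS cz => y /ltW.
  by move=> zl'; apply/eqP; rewrite eq_le zl zl'.
move=> zl; split; last by rewrite /body /= zl ltxx.
move=> A Az.
have : \forall t \near (1 : R)^'-, A (t *: z).
  have : (fun t : R => t *: z) @ 1^'- --> 1 *: z.
    by apply: cvg_at_left_filter; exact: scalel_continuous.
  by rewrite scale1r; apply.
move=> At; near (1 : R)^'- => t.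
exists (t *: z); split; last by near: t.
apply: scale_sublevel; first by rewrite zl.
by apply/andP; split; near: t; [exact: nbhs_left_ge|exact: nbhs_left_lt].
Unshelve. all: by end_near. Qed.

(** The midpoint of a segment on the curve has the same level as the ends, so midpoint convexity is
    an equality in each coordinate separately. Strictness then makes both coordinates of the ends
    agree. *)
Lemma body_no_segment : ~ contains_segment (boundary body).
Proof.
rewrite boundary_body => -[x [y [xy H]]].
have := H 0; rewrite lexx ler01 subr0 scale1r scale0r addr0 => /(_ isT) /= Hx.
have := H 1; rewrite lexx ler01 subrr scale1r scale0r add0r => /(_ isT) /= Hy.
have := H (2^-1); have -> : 0 <= (2^-1 : R) <= 1 by lra.
move=> /(_ isT) /=; rewrite /GRing.scale /=.
have -> : 1 - 2^-1 = 2^-1 :> R by lra.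
set m1 := 2^-1 * _ + _; set m2 := 2^-1 * x.2 + _ => Hm.
have [/ler_normlP[??] /ler_normlP[??]] : `|x.1| <= 1 /\ `|x.2| <= 1.
  by apply: sublevel_box; rewrite Hx.
have [/ler_normlP[??] /ler_normlP[??]] : `|y.1| <= 1 /\ `|y.2| <= 1.
  by apply: sublevel_box; rewrite Hy.
have P a b : -1 <= a <= 1 -> -1 <= b <= 1 ->
    2 * f (2^-1 * a + 2^-1 * b) <= f a + f b ?= iff (a == b).
  move=> ha hb; split.
    have := profile_subgrad (2^-1 * a + 2^-1 * b) a.
    have := profile_subgrad (2^-1 * a + 2^-1 * b) b; lra.
  apply/eqP/eqP => [|->]; last by rewrite (_ : 2^-1 * b + 2^-1 * b = b); lra.
  move=> e; apply/eqP/negPn/negP => ab.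
  have := @profile_strict a (2^-1 * a + 2^-1 * b) ha.
  have := @profile_subgrad R (2^-1 * a + 2^-1 * b) b.
  have -> : -1 <= 2^-1 * a + 2^-1 * b <= 1 by lra.
  have -> : a != 2^-1 * a + 2^-1 * b.
    by apply: contra ab => /eqP h; apply/eqP; lra.
  by move=> h /(_ isT isT); lra.
have [l1 e1] : 2 * f m1 <= f x.1 + f y.1 ?= iff (x.1 == y.1) by apply: P; lra.
have [l2 e2] : 2 * f m2 <= f x.2 + f y.2 ?= iff (x.2 == y.2) by apply: P; lra.
have E1 : 2 * f m1 == f x.1 + f y.1 by apply/eqP; lra.
have E2 : 2 * f m2 == f x.2 + f y.2 by apply/eqP; lra.
rewrite e1 in E1; rewrite e2 in E2.
by apply: xy; apply/eqP; rewrite -pair_eqE /pair_eq E1.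
Qed.

End Geometry.

(** * The boundary as a graph *)

Section Charts.
Context {R : realType}.
Implicit Types (x y s t : R) (z e : R * R).

Local Notation f := (@profile R).
Local Notation g := (@slope R).

(** The inverse of the profile on the nonnegative half-line, with value 0 where there is no
    preimage. *)
Definition profile_inv (v : R) : R := xget 0 [set y | 0 <= y /\ f y = v].

Definition height x : R := profile_inv (level - f x).

Lemma profile_inj x y : 0 <= x -> 0 <= y -> f x = f y -> x = y.
Proof.
move=> x0 y0 e; apply/eqP; rewrite eq_le.
by rewrite -{1}(ger0_norm x0) -{1}(ger0_norm y0) -{2}(ger0_norm x0)
  -{2}(ger0_norm y0) -!profile_leE e lexx.
Qed.

Lemma profileK y : 0 <= y -> profile_inv (f y) = y.
Proof.
move=> y0; rewrite /profile_inv; case: xgetP => [x _ [x0 e]|/(_ y)].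
  exact: profile_inj.
by move=> /not_andP[].
Qed.

Lemma heightP x : `|x| <= 1 -> 0 <= height x /\ f x + f (height x) = level.
Proof.
move=> x1.
have h1 : f x <= f 1 by rewrite profile_leE normr1.
have h0 : f 0 <= f x by rewrite profile_leE normr0.
have [|||c] := @IVT R f 0 1 (level - f x); first by [].
- exact/continuous_subspaceT/profile_continuous.
- have : f 0 <= f 1 by apply: le_trans h1.
  move=> h01; rewrite (min_idPl h01) (max_idPr h01) /level.
  by apply/andP; split; lra.
rewrite in_itv/= => /andP[c0 _] fc.
by rewrite /height -fc profileK//; split=> //; rewrite fc; lra.
Qed.

Lemma heightE x y : 0 <= y -> f x + f y = level -> y = height x.
Proof. by move=> y0; rewrite /height => <-; rewrite addrAC subrr add0r profileK. Qed.

Lemma height_gt0 x : `|x| < 1 -> 0 < height x.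
Proof.
move=> x1; have [h0 h] := heightP (ltW x1).
rewrite lt_neqAle h0 andbT; apply/eqP => e; move: h; rewrite -e /level addrC.
move=> /addrI => e'; move: x1.
by rewrite -[ltRHS]normr1 -profile_ltE e' ltxx.
Qed.

(** Implicit differentiation of [f x + f (height x) = level]; the denominator is nonzero because the
    height is positive inside the interval. *)
Lemma height_is_derive x : `|x| < 1 -> is_derive x 1 height (- g x / g (height x)).
Proof.
move=> x1; have H0 := height_gt0 x1; have [_ hx] := heightP (ltW x1).
have Hinv : is_derive (f (height x)) 1 profile_inv (g (height x))^-1.
  apply: is_derive_inverse; last by rewrite gt_eqF ?slope_gt0.
  - near=> y; apply: profileK; apply: ltW.
    near: y; exact: lt_nbhsr.
  - near=> y; exact: profile_continuous.
  - exact: profile_is_derive.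
have Hlin : is_derive x 1 (fun x => level - f x) (- g x).
  rewrite -[- g x]add0r; apply: is_deriveD.
  by apply: is_deriveN; exact: profile_is_derive.
have e : f (height x) = level - f x by lra.
rewrite e in Hinv; rewrite mulrC.
exact: (@is_derive1_comp _ profile_inv (fun x => level - f x) x _ _ Hinv Hlin).
Unshelve. all: by end_near. Qed.

Lemma height_continuous x : `|x| < 1 -> {for x, continuous height}.
Proof.
move=> x1; apply: differentiable_continuous; apply/derivable1_diffP.
by have [] := height_is_derive x1.
Qed.

Lemma height_C1 : C1_on (-1) 1 height.
Proof.
move=> s; rewrite in_itv/= => s1.
have {}s1 : `|s| < 1 by rewrite ltr_norml.
split; first by have [] := height_is_derive s1.
have e : \forall t \near s, - g t / g (height t) = derive1 height t.
  near=> t; rewrite derive1E; apply/esym.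
  have [_ ->//] : is_derive t 1 height (- g t / g (height t)).
  apply: height_is_derive; near: t.
  have : (fun u : R => `|u|) @ s --> `|s| by exact: norm_continuous.
  by move=> /(_ [set v | v < 1]); apply; exact: lt_nbhsl.
have es : - g s / g (height s) = derive1 height s := nbhs_singleton e.
suff : derive1 height @ s --> derive1 height s by [].
rewrite -es.
apply: cvg_trans; first by apply: near_eq_cvg; exact: e.
apply: cvgM; first by apply: cvgN; exact: slope_continuous.
apply: cvgV; first by rewrite gt_eqF// slope_gt0// height_gt0.
by apply: continuous_comp; [exact: height_continuous|exact: slope_continuous].
Unshelve. all: by end_near. Qed.

Lemma dot_continuous e : continuous (fun z => dot z e).
Proof.
move=> z; apply: cvgD; apply: cvgM; by [exact: cvg_cst|exact: cvg_fst|exact: cvg_snd].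
Qed.

(** One chart serves the whole boundary: in each frame obtained from the axes by a symmetry of the
    square, the half-plane towards [e2] sees the graph of [height]. *)
Lemma height_chart e1 e2 z : orthonormal e1 e2 ->
  (forall s t, f (s *: e1 + t *: e2).1 + f (s *: e1 + t *: e2).2 = f s + f t) ->
  (forall z, z = dot z e1 *: e1 + dot z e2 *: e2) ->
  0 < dot z e2 ->
  exists U : set (R * R), nbhs z U /\
  exists e1 e2 : R * R, orthonormal e1 e2 /\
  exists (a b : R) (phi : R -> R), C1_on a b phi /\
    boundary body `&` U = [set s *: e1 + phi s *: e2 | s in `]a, b[].
Proof.
move=> on sep dec ze2; exists [set w | 0 < dot w e2]; split.
  have : (fun z => dot z e2) @ z --> dot z e2 by exact: dot_continuous.
  by move=> /(_ [set v | 0 < v]); apply; exact: lt_nbhsr.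
exists e1, e2; split=> //; exists (-1), 1, height; split; first exact: height_C1.
rewrite boundary_body; apply/seteqP; split=> [w /= [lw w0]|w /= [s]].
  rewrite (dec w) sep in lw; exists (dot w e1).
    rewrite /= in_itv/= -ltr_norml -[ltRHS]normr1 -profile_ltE.
    have : f 0 < f (dot w e2) by rewrite profile_ltE normr0 normr_gt0 gt_eqF.
    by move: lw; rewrite /level; lra.
  by rewrite -(heightE (ltW w0) lw) -dec.
rewrite in_itv/= -ltr_norml => s1 <-.
rewrite sep; have [_ ->] := heightP (ltW s1); split=> //.
have -> : dot (s *: e1 + height s *: e2) e2 = s * dot e1 e2 + height s * dot e2 e2.
  by rewrite /dot /= /GRing.scale /=; ring.
by have [_ -> ->] := on; rewrite mulr0 add0r mulr1 height_gt0.
Qed.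

Lemma body_C1_boundary : C1_boundary (@body R).
Proof.
move=> z bz; have zl : f z.1 + f z.2 = level by move: bz; rewrite boundary_body.
have fN := @profile_even R.
have [z2|z2|z2] := ltgtP z.2 0.
- apply: (@height_chart (1, 0) (0, -1)).
  + by rewrite /orthonormal /dot /=; split; ring.
  + move=> s t; rewrite /= /GRing.scale /= -(fN t).
    by congr (f _ + f _); ring.
  + by move=> [a b]; apply: injective_projections; rewrite /dot /= /GRing.scale /=; ring.
  + by rewrite /dot /=; lra.
- apply: (@height_chart (1, 0) (0, 1)).
  + by rewrite /orthonormal /dot /=; split; ring.
  + by move=> s t; rewrite /= /GRing.scale /=; congr (f _ + f _); ring.
  + by move=> [a b]; apply: injective_projections; rewrite /dot /= /GRing.scale /=; ring.
  + by rewrite /dot /=; lra.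
(* At the two points on the first axis the curve is vertical, so the coordinates exchange roles. *)
have [z1|z1] := level_on_axis zl z2.
- apply: (@height_chart (0, 1) (1, 0)).
  + by rewrite /orthonormal /dot /=; split; ring.
  + by move=> s t; rewrite /= /GRing.scale /= addrC; congr (f _ + f _); ring.
  + by move=> [a b]; apply: injective_projections; rewrite /dot /= /GRing.scale /=; ring.
  + by rewrite /dot /= z1; lra.
- apply: (@height_chart (0, 1) (-1, 0)).
  + by rewrite /orthonormal /dot /=; split; ring.
  + move=> s t; rewrite /= /GRing.scale /= addrC -(fN t).
    by congr (f _ + f _); ring.
  + by move=> [a b]; apply: injective_projections; rewrite /dot /= /GRing.scale /=; ring.
  + by rewrite /dot /= z1; lra.
Qed.

End Charts.

(** * Oscillatory integrals and measurability in the plane *)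

Lemma integrable_bounded (R : realType) d (T : measurableType d) (m : {measure set T -> \bar R})
    (D : set T) (h : T -> R) (M : R) :
  measurable D -> (m D < +oo)%E -> measurable_fun D h ->
  (forall x, D x -> `|h x| <= M) -> m.-integrable D (EFin \o h).
Proof.
move=> mD fD mh hM; apply/integrableP; split; first exact/measurable_EFinP.
apply: (@le_lt_trans _ _ (\int[m]_(x in D) (cst `|M|%:E) x)%E).
  apply: ge0_le_integral => //.
  - by apply/measurable_EFinP; exact: measurableT_comp.
  - by move=> x Dx; rewrite /= lee_fin (le_trans (hM _ Dx))// ler_norm.
by rewrite integral_cst// lte_mul_pinfty.
Qed.

Section PlaneMeasurability.
Context {R : realType}.

Local Notation plane := (measurableTypeR R * measurableTypeR R)%type.

Lemma rat_near (x r : R) : 0 < r -> exists q : rat, ball (ratr q : R) r x.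
Proof.
move=> r0; have [|q] := @rat_in_itvoo R (x - r) (x + r); first by lra.
rewrite in_itv/= => /andP[q1 q2]; exists q.
by rewrite /ball/= ltr_norml; apply/andP; split; lra.
Qed.

(** Measurability refers to the product sigma-algebra, so an open set is written as a countable
    union of boxes with rational centres and radii 1 / (k + 1). *)
Lemma open_plane_measurable (U : set (R * R)) : open U -> @measurable _ plane U.
Proof.
move=> oU.
pose box (i : rat * rat * nat) : set (R * R) :=
  ball (ratr i.1.1 : R) i.2.+1%:R^-1 `*` ball (ratr i.1.2 : R) i.2.+1%:R^-1.
pose F i := if `[< box i `<=` U >] then box i else set0.
have -> : U = \bigcup_i F i.
  apply/seteqP; split=> z; last first.
    by move=> [i _]; rewrite /F; case: asboolP => // + zi; apply.
  move=> Uz; have := open_nbhs_nbhs (conj oU Uz).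
  rewrite -nbhs_ballE => -[e /= e0 zU].
  have [k ke] : exists k, k.+1%:R^-1 < e / 2.
    exists (Num.truncn (2 / e)); rewrite invf_plt ?posrE ?divr_gt0//.
    by rewrite invf_div truncnS_gt.
  have k0 : 0 < k.+1%:R^-1 :> R by rewrite invr_gt0.
  have [q1 zq1] := rat_near z.1 k0; have [q2 zq2] := rat_near z.2 k0.
  exists (q1, q2, k) => //; rewrite /F asboolT//= => w [w1 w2].
  apply: zU; split; rewrite /=.
    apply: (@le_ball _ _ _ (k.+1%:R^-1 + k.+1%:R^-1)); first by move: ke; set r := _^-1; lra.
    by apply: ball_triangle w1; apply: ball_sym.
  apply: (@le_ball _ _ _ (k.+1%:R^-1 + k.+1%:R^-1)); first by move: ke; set r := _^-1; lra.
  by apply: ball_triangle w2; apply: ball_sym.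
apply: countable_bigcupT_measurable => [|i]; first exact: countableP.
rewrite /F; case: asboolP => // _.
by apply: measurableX; rewrite ball_itv; exact: measurable_itv.
Qed.

Lemma continuous_plane_measurable (h : R * R -> R) :
  continuous h -> measurable_fun (setT : set plane) h.
Proof.
move=> /continuousP ch; apply: (measurability _ (RGenOpens.measurableE R)).
move=> _ [_ [a [b ->] <-]]; rewrite setTI; apply: open_plane_measurable.
exact/ch/interval_open.
Qed.

End PlaneMeasurability.

Section Oscillation.
Context {R : realType}.
Implicit Types (a b u v x y : R).

Local Notation mu := (@lebesgue_measure R).

Lemma cos_lip x y : `|cos x - cos y| <= `|x - y|.
Proof.
wlog xy : x y / y <= x => [H|].
  by have [/H//|/ltW/H] := leP y x; rewrite distrC (distrC y).
have dcos (z : R) : z \in `]y, x[ ->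
    is_derive z 1 (@cos R) (- sin z) by move=> _; exact: is_derive_cos.
have [|c _ ->] := MVT_segment xy dcos.
  exact/continuous_subspaceT/continuous_cos.
by rewrite normrM normrN ler_piMl// sin_max.
Qed.

(** Joins the two bounds for the integral of [cos (u * x + v)] over a part of [-1, 1]: the length 2
    at low frequency, and 2 / |u| from the antiderivative. *)
Definition decay u : R := 2 / Num.max 1 `|u|.

Lemma decay_gt0 u : 0 < decay u.
Proof. by rewrite divr_gt0// lt_max ltr01. Qed.

Lemma decay_le2 u : decay u <= 2.
Proof. by rewrite ler_pdivrMr ?lt_max ?ltr01// ler_peMr// le_max lexx. Qed.

Lemma affine_cos_continuous u v : continuous (fun x => cos (u * x + v)).
Proof.
move=> x; apply: continuous_comp; last exact: continuous_cos.
by apply: cvgD; [apply: cvgM; [exact: cvg_cst|exact: cvg_id]|exact: cvg_cst].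
Qed.

Lemma itv_measure_lty (p q : R) : (mu `[p, q] < +oo)%E.
Proof. by rewrite lebesgue_measure_itv/=; case: ifP => _; rewrite ?ltry. Qed.

Lemma itv_measureE (p q : R) : p <= q -> mu `[p, q] = (q - p)%:E.
Proof.
rewrite lebesgue_measure_itv/= lte_fin le_eqVlt => /predU1P[->|->].
  by rewrite ltxx subrr.
by rewrite EFinB.
Qed.

Lemma affine_cos_measurable u v : measurable_fun setT (fun x => cos (u * x + v)).
Proof. by apply: continuous_measurable_fun; exact: affine_cos_continuous. Qed.

Lemma integral_cos u v p q : u != 0 -> p <= q ->
  (\int[mu]_(x in `[p, q]) (cos (u * x + v))%:E =
   ((sin (u * q + v) - sin (u * p + v)) / u)%:E)%E.
Proof.
move=> u0; rewrite le_eqVlt => /predU1P[->|pq].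
  by rewrite set_itv1 integral_set1 subrr mul0r.
pose F x := u^-1 * sin (u * x + v).
have dF x : is_derive x 1 F (cos (u * x + v)).
  have h : is_derive x 1 (fun x => u * x + v) u.
    by apply: is_derive_eq; rewrite addr0 [_ *: _]mulr1.
  have h2 := @is_derive1_comp _ sin (fun x => u * x + v) x _ _ _ h.
  have -> : cos (u * x + v) = u^-1 *: (cos (u * x + v) * u).
    by rewrite /GRing.scale/=; field.
  exact: is_deriveZ.
have cF : continuous F.
  by move=> x; apply: differentiable_continuous; apply/derivable1_diffP; case: (dF x).
rewrite (@continuous_FTC2 _ _ F)//.
- by rewrite -EFinB /F; congr EFin; ring.
- exact/continuous_subspaceT/affine_cos_continuous.
- split=> [x _||]; first by case: (dF x).
    exact/cvg_at_right_filter/cF.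
  exact/cvg_at_left_filter/cF.
- by move=> x _; rewrite derive1E; case: (dF x).
Qed.

Lemma interval_cos (C : set R) u v : is_interval C -> C `<=` `[-1, 1] ->
  `|\int[mu]_(x in C) cos (u * x + v)| <= decay u.
Proof.
move=> iC C1; have [->|/set0P[c Cc]] := eqVneq C set0.
  by rewrite Rintegral_set0 normr0 ltW// decay_gt0.
have lC : has_lbound C by exists (-1) => x /C1; rewrite /= in_itv/= => /andP[].
have uC : has_ubound C by exists 1 => x /C1; rewrite /= in_itv/= => /andP[].
have [p [q [pq p1 q1 ->]]] : exists p q : R, [/\ p <= q, -1 <= p, q <= 1 &
    \int[mu]_(x in C) cos (u * x + v) = \int[mu]_(x in `[p, q]) cos (u * x + v)].
  exists (inf C), (sup C).
  have ic : inf C <= c by apply: ge_inf.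
  have cs : c <= sup C by apply: ub_le_sup.
  split.
  - exact: le_trans cs.
  - by apply: lb_le_inf; [exists c|move=> x /C1; rewrite /= in_itv/= => /andP[]].
  - by apply: ge_sup; [exists c|move=> x /C1; rewrite /= in_itv/= => /andP[]].
  move/is_intervalP : iC => {1}->; rewrite /Rhull (asboolT lC) (asboolT uC).
  have mc : measurable_fun `]inf C, sup C[ (fun x => (cos (u * x + v))%:E).
    by apply/measurable_EFinP/measurable_funTS; exact: affine_cos_measurable.
  by rewrite /Rintegral integral_itv_bndoo// [in RHS]integral_itv_bndoo.
have [u1|u1] := leP `|u| 1.
  apply: le_trans (le_normr_Rintegral _ _) _ => //.
    apply: (@integrable_bounded _ _ _ _ _ _ 1) => //.
    - exact: itv_measure_lty.
    - by apply: measurable_funTS; exact: affine_cos_measurable.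
    - by move=> x _; exact: cos_max.
  apply: (@le_trans _ _ (\int[mu]_(x in `[p, q]) 1)).
    apply: le_Rintegral => //.
    - apply: (@integrable_bounded _ _ _ _ _ _ 1) => //.
      + exact: itv_measure_lty.
      + apply: measurableT_comp => //.
        by apply: measurable_funTS; exact: affine_cos_measurable.
      + by move=> x _; rewrite normr_id cos_max.
    - apply: (@integrable_bounded _ _ _ _ _ _ 1) => //.
      + exact: itv_measure_lty.
      + by move=> x _; rewrite normr1.
    - by move=> x _; exact: cos_max.
  rewrite Rintegral_cst// mul1r /decay (max_idPl u1) divr1.
  have h : fine (mu `[p, q]) <= 2 by rewrite itv_measureE//=; lra.
  exact: h.
have u0 : u != 0 by rewrite -normr_gt0; lra.
rewrite /Rintegral integral_cos//= normrM normfV /decay (max_idPr (ltW u1)).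
rewrite ler_pM2r ?invr_gt0 ?normr_gt0//.
apply: le_trans (ler_normB _ _) _.
by have := sin_max (u * q + v); have := sin_max (u * p + v); lra.
Qed.

End Oscillation.

Section DecayIntegral.
Context {R : realType}.
Implicit Types (u v q : R).

Local Notation mu := (@lebesgue_measure R).

Lemma decay_measurable v : measurable_fun setT (fun u => decay (u + v)).
Proof.
apply: continuous_measurable_fun => u.
apply: cvgM; first exact: cvg_cst.
apply: cvgV; first by rewrite gt_eqF// lt_max ltr01.
apply: (@continuous_comp _ _ _ (fun u => u + v) (fun w => Num.max 1 `|w|)).
  by apply: cvgD; [exact: cvg_id|exact: cvg_cst].
apply: (@continuous_comp _ _ _ (fun w : R => `|w|) (fun w => Num.max 1 w)).
  exact: norm_continuous.
by apply: (@continuous_max _ _ (fun _ => 1) id); [exact: cvg_cst|exact: cvg_id].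
Qed.

Lemma decay_dyadic u : exists j, `|u| < 2 ^+ j.+1 /\ decay u <= 2 / 2 ^+ j.
Proof.
have [n un] : exists n, `|u| < 2 ^+ n.+1.
  exists (Num.truncn `|u|); apply: lt_le_trans (truncnS_gt _) _.
  by rewrite -natrX ler_nat ltnW// ltn_expl.
have := ex_minnP (ex_intro (fun n => `|u| < 2 ^+ n.+1) n un).
move=> [j uj jmin]; exists j; split=> //.
case: j uj jmin => [|j] uj jmin; first by rewrite expr0 divr1 decay_le2.
rewrite ler_pM2l// lef_pV2 ?posrE ?exprn_gt0// ?lt_max ?ltr01//.
rewrite le_max; apply/orP; right; rewrite leNgt; apply/negP => /jmin.
by rewrite ltnn.
Qed.

(** Dyadic summation: the shell |u + v| ~ 2^j has length of order 2^j and contributes of order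
    2^(j(1-q)). The constant is the same for all shifts v, hence for all edges. *)
Lemma decay_integral q : 1 < q ->
  exists C : R, forall v, (\int[mu]_u ((decay (u + v)) `^ q)%:E <= C%:E)%E.
Proof.
move=> q1; have t0 : 0 < 2 `^ q :> R by rewrite powR_gt0.
pose r : R := (2 `^ q)^-1.
have r0 : 0 < r by rewrite invr_gt0.
have r2 : 2 * r < 1.
  rewrite ltr_pdivrMr// mul1r -(@mulr_powRB1 _ 2 q)//; last by lra.
  rewrite ltr_pMr// -[ltLHS]/((fun=> 1) (q - 1)) -powR1.
  by rewrite gt0_ltr_powR ?nnegrE//; lra.
have dq j : (2 / 2 ^+ j) `^ q = 2 `^ q * r ^+ j :> R.
  rewrite powRM// ?invr_ge0 ?exprn_ge0//; congr (_ * _).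
  rewrite -powR_inv1 ?exprn_ge0// powRAC powR_inv1 ?powR_ge0// /r exprVn.
  by rewrite -powR_mulrn// powRAC powR_mulrn// powR_ge0.
exists (4 * 2 `^ q / (1 - 2 * r)) => v.
pose F j u : \bar R := (2 `^ q * r ^+ j * \1_(ball (- v) (2 ^+ j.+1 : R)) u)%:E.
have mF j : measurable_fun setT (F j).
  apply/measurable_EFinP; apply: measurable_funM => //.
  by apply: measurable_indic; rewrite ball_itv; exact: measurable_itv.
have F0 j u : (0 <= F j u)%E.
  by rewrite lee_fin !mulr_ge0 ?powR_ge0 ?exprn_ge0 ?(ltW r0).
apply: (@le_trans _ _ (\int[mu]_u (\sum_(j <oo) F j u))%E).
  apply: ge0_le_integral => //.
  - by move=> u _; rewrite lee_fin powR_ge0.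
  - apply/measurable_EFinP.
    apply: (@measurableT_comp _ _ _ _ _ _ (fun w : R => w `^ q)).
      exact: measurable_powR.
    exact: decay_measurable.
  - by apply: (@ge0_emeasurable_sum _ _ _ setT F xpredT) => *; rewrite ?F0.
  move=> u _; have [j [uj dj]] := decay_dyadic (u + v).
  apply: (@le_trans _ _ (F j u)).
    rewrite lee_fin indicE mem_set; last by rewrite /ball/= -opprD normrN addrC.
    rewrite mulr1 -dq; apply: ge0_ler_powR; rewrite ?nnegrE//.
      by lra.
    exact/ltW/decay_gt0.
  apply: le_trans (_ : (\sum_(0 <= i < j.+1) F i u <= _)%E); last first.
    by apply: nneseries_lim_ge => i _ _; exact: F0.
  by rewrite big_nat_recr//= leeDr// sume_ge0.
rewrite integral_nneseries//.
have FE j : (\int[mu]_u F j u)%E = (geometric (4 * 2 `^ q) (2 * r) j)%:E.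
  rewrite /F; under eq_integral do rewrite EFinM.
  rewrite ge0_integralZl//; last 2 first.
  - apply/measurable_EFinP; apply: measurable_indic.
    by rewrite ball_itv; exact: measurable_itv.
  - by rewrite lee_fin mulr_ge0 ?powR_ge0 ?exprn_ge0 ?(ltW r0).
  rewrite integral_indic//; last by rewrite ball_itv; exact: measurable_itv.
  have mb : mu (ball (- v : R) (2 ^+ j.+1)) = (2 ^+ j.+1 *+ 2)%:E.
    by rewrite lebesgue_measure_ball ?exprn_ge0.
  rewrite setIT; transitivity ((2 `^ q * r ^+ j)%:E * (2 ^+ j.+1 *+ 2)%:E)%E.
    by congr (_ * _)%E; exact: mb.
  rewrite -EFinM; congr EFin.
  by rewrite /= exprMn exprS mulr2n; ring.
under eq_eseriesr do rewrite FE.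
have -> : (\sum_(i <oo) (geometric (4 * 2 `^ q) (2 * r) i)%:E =
          (4 * 2 `^ q / (1 - 2 * r))%:E)%E; last by [].
apply/cvg_lim => //; under eq_fun do rewrite sumEFin.
apply: cvg_EFin; first by near=> n.
by apply: cvg_geometric_series; rewrite ger0_norm//; lra.
Unshelve. all: by end_near. Qed.

End DecayIntegral.

Section PlaneMeasure.
Context {R : realType}.

Local Notation plane := (measurableTypeR R * measurableTypeR R)%type.

(* For a bare product measure, canonical structure inference only finds the
   sigma-finite instance that requires subprobabilities, hence this alias. *)
Definition plane_measure : set plane -> \bar R :=
  (@lebesgue_measure R \x @lebesgue_measure R)%E.

HB.instance Definition _ := Measure.copy plane_measure
  (@lebesgue_measure R \x @lebesgue_measure R)%E.

Lemma plane_measure_sigma_finite : sigma_finite setT plane_measure.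
Proof.
pose F n : set (measurableTypeR R) := `](- n%:R), n%:R[%classic.
have mF n : measurable (F n) by exact: measurable_itv.
have Foo n : (@lebesgue_measure R (F n) < +oo)%E.
  by rewrite lebesgue_measure_itv/=; case: ifP; rewrite -?EFinB ltry.
exists (fun n => F n `*` F n) => [|n].
  apply/esym/seteqP; split=> // z _.
  exists (Num.truncn `|z|).+1 => //; have := truncnS_gt `|z|.
  by rewrite prod_normE gt_max => /andP[z1 z2]; split; rewrite /F/= in_itv/= -ltr_norml.
split; first exact: measurableX.
rewrite /plane_measure product_measure1E//; apply: lte_mul_pinfty.
- exact: measure_ge0.
- by rewrite ge0_fin_numE; [exact: Foo|exact: measure_ge0].
- exact: Foo.
Qed.

HB.instance Definition _ := Measure_isSigmaFinite.Build _ _ _ plane_measure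
  plane_measure_sigma_finite.

End PlaneMeasure.

(** * Decay of the Fourier transform *)

Section Cells.
Context {R : realType}.
Implicit Types (x y z a b v : R) (n k l : nat).

Local Notation mu := (@lebesgue_measure R).
Local Notation f := (@profile R).
Local Notation H := (@height R).

Lemma height_antitone x y : `|x| <= `|y| -> `|y| <= 1 -> H y <= H x.
Proof.
move=> xy y1; have [h0 h] := heightP (le_trans xy y1); have [k0 k] := heightP y1.
have : f x <= f y by rewrite profile_leE.
have : f (H y) <= f (H x) -> H y <= H x by rewrite profile_leE !ger0_norm.
lra.
Qed.

Definition cell n k l : set R :=
  [set x | [/\ `|x| < 1, rank n x = k & rank n (H x) = l]].

(** The points of a cell lie on one side of 0, where [height] is monotone, so both ranks are
    squeezed between their values at the ends. *)
Lemma cell_interval n k l : is_interval (cell n k l).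
Proof.
move=> x y [x1 xk xl] [y1 yk yl] z /andP[xz zy].
have zk : rank n z = k.
  by apply/eqP; rewrite eqn_leq -{1}yk (rank_homo n zy) -xk (rank_homo n xz).
have s : (0 < x) = (0 < y) by apply: (@rank_sign _ n); rewrite xk.
have z1 : `|z| < 1 by move: x1 y1; rewrite !ltr_norml => /andP[? ?] /andP[? ?]; lra.
split=> //; have [x0|x0] := ltP 0 x.
  have z0 : 0 < z by lra.
  have y0 : 0 < y by lra.
  have h1 : H y <= H z by apply: height_antitone; [rewrite !gtr0_norm|exact: ltW].
  have h2 : H z <= H x by apply: height_antitone; [rewrite !gtr0_norm|exact: ltW].
  by apply/eqP; rewrite eqn_leq -{1}xl (rank_homo n h2) -yl (rank_homo n h1).
have y0 : y <= 0 by rewrite leNgt -s -leNgt.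
have z0 : z <= 0 by lra.
have h1 : H x <= H z by apply: height_antitone; [rewrite !ler0_norm//; lra|exact: ltW].
have h2 : H z <= H y by apply: height_antitone; [rewrite !ler0_norm//; lra|exact: ltW].
by apply/eqP; rewrite eqn_leq -{1}yl (rank_homo n h2) -xl (rank_homo n h1).
Qed.

Lemma cell_measurable n k l : measurable (cell n k l).
Proof. by apply: is_interval_measurable; exact: cell_interval. Qed.

Lemma cell_sub n k l : cell n k l `<=` `]-1, 1[.
Proof. by move=> x [x1 _ _]; rewrite /= in_itv/= -ltr_norml. Qed.

Lemma height_le1 x : `|x| <= 1 -> H x <= 1.
Proof.
move=> x1; have [h0 h] := heightP x1.
have f0 : f 0 <= f x by rewrite profile_leE normr0.
have : f (H x) <= f 1 by move: h; rewrite /level; lra.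
by rewrite profile_leE normr1 ger0_norm.
Qed.

(** Four evaluations of the profile, each with error [16 * gap n], divided by a slope of at least
    3^(-n). *)
Definition flatness n : R := 64 * (3 ^+ n * gap n).

Lemma flatness_gt0 n : 0 < flatness n.
Proof. by rewrite !mulr_gt0// ?exprn_gt0// gap_gt0. Qed.

(** On a cell the n-th profile is affine both at x and at [H x], while the exact sum [f x + f (H x)]
    is constant; so a linear relation between x and [H x] holds up to [64 * gap n], and it is solved
    for [H x]. *)
Lemma cell_affine n k l : exists s h0 : R, forall x, cell n k l x ->
  `|H x - (h0 + s * x)| <= flatness n.
Proof.
have [[x0 [x1 xk xl]]|nC] := pselect (exists x, cell n k l x); last first.
  by exists 0, 0 => x Cx; exfalso; apply: nC; exists x.
set sk := pl_slope n x0; set sl := pl_slope n (H x0).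
have H0 := height_gt0 x1; have [_ e0] := heightP (ltW x1).
have p3 : 0 < (3 ^+ n)^-1 :> R by rewrite invr_gt0 exprn_gt0.
(* The slope at [H x0] is at least the mean slope between 0 and [H x0]. *)
have slge : (3 ^+ n)^-1 <= sl.
  have := pl_profile_subgrad n (H x0) 0; have := @pl_profile_slope_ge _ n 0 (H x0).
  rewrite lexx (ltW H0) => /(_ isT); rewrite -/sl subr0 sub0r mulrN => h1 h2.
  rewrite -(ler_pM2r H0); lra.
exists (- (sk / sl)), (H x0 + sk / sl * x0) => x [xx1 xxk xxl].
have [_ e] := heightP (ltW xx1).
have [_ a1] : pl_slope n x0 = pl_slope n x /\ pl_profile n x - pl_profile n x0 = sk * (x - x0).
  by apply: rank_affine; rewrite xk xxk.
have [_ a2] : pl_slope n (H x0) = pl_slope n (H x) /\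
    pl_profile n (H x) - pl_profile n (H x0) = sl * (H x - H x0).
  by apply: rank_affine; rewrite xl xxl.
have d1 := profile_approx1 n (ltW x1); have d2 := profile_approx1 n (ltW xx1).
have hn y : `|y| < 1 -> `|H y| <= 1.
  by move=> y1; rewrite gtr0_norm ?height_gt0// height_le1// ltW.
have d3 := profile_approx1 n (hn _ x1); have d4 := profile_approx1 n (hn _ xx1).
have D : `|sk * (x - x0) + sl * (H x - H x0)| <= 64 * gap n.
  rewrite -a1 -a2.
  move: d1 d2 d3 d4; rewrite !ler_norml => /andP[? ?] /andP[? ?] /andP[? ?] /andP[? ?].
  by apply/andP; split; lra.
have sl0 : 0 < sl by lra.
have -> : H x - (H x0 + sk / sl * x0 + - (sk / sl) * x) =
    (sk * (x - x0) + sl * (H x - H x0)) / sl by field; rewrite gt_eqF.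
rewrite normrM normfV (gtr0_norm sl0) ler_pdivrMr//; apply: le_trans D _.
rewrite /flatness -!mulrA ler_pM2l//.
rewrite mulrCA -[leLHS]mulr1 ler_pM2l ?gap_gt0//.
by rewrite mulrC -ler_pdivrMr ?exprn_gt0// mul1r.
Qed.

Lemma height_measurable : measurable_fun (`]-1, 1[ : set R) H.
Proof.
apply: open_continuous_measurable_fun; first exact: interval_open.
by move=> x; rewrite inE/= in_itv/= -ltr_norml; exact: height_continuous.
Qed.

Lemma cos_height_measurable a b v :
  measurable_fun (`]-1, 1[ : set R) (fun x => cos (a * x + b * H x + v)).
Proof.
apply: (@measurableT_comp _ _ _ _ _ _ (@cos R)).
  by apply: continuous_measurable_fun; exact: continuous_cos.
apply: measurable_funD => //; apply: measurable_funD.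
  by apply: measurable_funM.
by apply: measurable_funM => //; exact: height_measurable.
Qed.

Lemma unit_itv_measure : mu (`]-1, 1[ : set R) = 2%:E.
Proof.
rewrite lebesgue_measure_itv/= lte_fin (_ : -1 < 1 = true :> bool); last by lra.
by rewrite -EFinB; congr EFin; lra.
Qed.

Lemma cell_measure_le n k l : (mu (cell n k l) <= 2%:E)%E.
Proof.
rewrite -unit_itv_measure.
have mC : cell n k l \in measurable by rewrite inE; exact: cell_measurable.
have mI : (`]-1, 1[%classic : set R) \in measurable by rewrite inE; exact: measurable_itv.
exact: (le_measure mu mC mI (@cell_sub n k l)).
Qed.

Lemma cell_integrable n k l a b v :
  mu.-integrable (cell n k l) (EFin \o (fun x => cos (a * x + b * H x + v))).
Proof.
have mC := cell_measurable n k l.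
apply: (@integrable_bounded _ _ _ _ _ _ 1) => //.
- by apply: le_lt_trans (cell_measure_le n k l) _; rewrite ltry.
- by apply: measurable_funS (cos_height_measurable a b v) => //; exact: cell_sub.
- by move=> x _; exact: cos_max.
Qed.

(** Replacing [H x] by the chord costs |b| times [flatness n] on a set of length at most 2; the
    remaining phase is linear with frequency a + s b. *)
Lemma cell_cos n k l a b v (s h0 : R) :
  (forall x, cell n k l x -> `|H x - (h0 + s * x)| <= flatness n) ->
  `|\int[mu]_(x in cell n k l) cos (a * x + b * H x + v)| <=
    decay (a + s * b) + 2 * `|b| * flatness n.
Proof.
move=> Hs; set C := cell n k l.
have mC : measurable C := cell_measurable n k l.
have Coo : (mu C < +oo)%E.
  by apply: le_lt_trans (cell_measure_le n k l) _; rewrite ltry.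
pose u x := cos (a * x + b * H x + v).
pose w x := cos ((a + s * b) * x + (b * h0 + v)).
have iu : mu.-integrable C (EFin \o u) := cell_integrable n k l a b v.
have iw : mu.-integrable C (EFin \o w).
  apply: (@integrable_bounded _ _ _ _ _ _ 1) => //; last by move=> x _; exact: cos_max.
  by apply: measurable_funTS; exact: affine_cos_measurable.
have -> : \int[mu]_(x in C) u x = \int[mu]_(x in C) w x + \int[mu]_(x in C) (u x - w x).
  by rewrite RintegralB// addrC subrK.
apply: le_trans (ler_normD _ _) _; apply: lerD.
  apply: interval_cos; first exact: cell_interval.
  by move=> x /cell_sub /=; rewrite !in_itv/= => /andP[? ?]; apply/andP; split; exact: ltW.
have iuw : mu.-integrable C (EFin \o (fun x => u x - w x)).
  have := @integrableB _ _ _ mu C mC _ _ iu iw.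
  by apply: eq_integrable => // x _; rewrite /= EFinB.
apply: le_trans (le_normr_Rintegral _ iuw) _ => //.
apply: (@le_trans _ _ (\int[mu]_(x in C) (`|b| * flatness n))).
  apply: le_Rintegral => //.
  - by apply: integrable_norm iuw.
  - apply: (@integrable_bounded _ _ _ _ _ _ (`|b| * flatness n)) => // x _.
    by rewrite ger0_norm// mulr_ge0// ltW// flatness_gt0.
  move=> x Cx; apply: le_trans (cos_lip _ _) _.
  have -> : a * x + b * H x + v - ((a + s * b) * x + (b * h0 + v)) =
    b * (H x - (h0 + s * x)) by ring.
  by rewrite normrM ler_wpM2l// Hs.
have h : fine (mu C) <= 2.
  by have := cell_measure_le n k l; rewrite -/C; case: (mu C) Coo => //=.
rewrite Rintegral_cst//; apply: le_trans (ler_wpM2l _ h) _.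
  by rewrite mulr_ge0// ltW// flatness_gt0.
by rewrite [leLHS]mulrC mulrA.
Qed.

Definition cells n := [seq (k, l) | k <- iota 0 (2 * 3 ^ n), l <- iota 0 (2 * 3 ^ n)].

Lemma cellsE n : \big[setU/set0]_(i <- cells n) cell n i.1 i.2 = `]-1, 1[%classic.
Proof.
apply/seteqP; split=> x.
  by rewrite -bigcup_seq => -[i _ /cell_sub].
rewrite /= in_itv/= -ltr_norml => x1; rewrite -bigcup_seq.
exists (rank n x, rank n (H x)) => //=.
by apply/allpairsP; exists (rank n x, rank n (H x)); rewrite !mem_iota !add0n !rank_lt.
Qed.

(** The slopes depend on n alone, which permits integrating the bound in a later. *)
Lemma cos_height_bound n : exists s : nat * nat -> R, forall a b v,
  `|\int[mu]_(x in `]-1, 1[) cos (a * x + b * H x + v)| <=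
    \sum_(i <- cells n) (decay (a + s i * b) + 2 * `|b| * flatness n).
Proof.
have /choice[s Hs] : forall i : nat * nat, exists s : R, exists h0 : R,
    forall x, cell n i.1 i.2 x -> `|H x - (h0 + s * x)| <= flatness n.
  by move=> i; exact: cell_affine.
exists s => a b v.
have -> : \int[mu]_(x in `]-1, 1[) cos (a * x + b * H x + v) =
  \sum_(i <- cells n) \int[mu]_(x in cell n i.1 i.2) cos (a * x + b * H x + v).
  rewrite {1}/Rintegral -(cellsE n) integral_bigsetU_EFin/=.
  - rewrite (eq_bigr (fun i : nat * nat =>
      (\int[mu]_(x in cell n i.1 i.2) cos (a * x + b * H x + v))%:E)).
      by rewrite sumEFin.
    move=> i _; rewrite /Rintegral fineK//.
    by apply: integrable_fin_num; [exact: cell_measurable|exact: cell_integrable].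
  - by move=> i; exact: cell_measurable.
  - by apply: allpairs_uniq; rewrite ?iota_uniq// => -[? ?] [? ?] _ _.
  - move=> [k l] [k' l'] _ _ [x [[_ xk xl] [_ xk' xl']]].
    by move: xk xl xk' xl' => /= <- <- <- <-.
  - by rewrite cellsE; apply/measurable_EFinP; exact: cos_height_measurable.
apply: le_trans (ler_norm_sum _ _ _) _; apply: ler_sum => i _.
by have [h0 h] := Hs i; exact: cell_cos h.
Qed.

End Cells.

(** * The transform reduced to integrals along the boundary *)

Section Wave.
Context {R : realType}.
Implicit Types (x y a b t : R) (z : R * R) (n : nat).

Local Notation mu := (@lebesgue_measure R).
Local Notation plane := (measurableTypeR R * measurableTypeR R)%type.
Local Notation leb2 := (@lebesgue_measure R \x @lebesgue_measure R)%E.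
Local Notation f := (@profile R).
Local Notation H := (@height R).

Lemma body_measurable : @measurable _ plane (@body R).
Proof. by apply: open_plane_measurable; exact: body_open. Qed.

Lemma body_measure_le : (leb2 (@body R : set plane) <= 4%:E)%E.
Proof.
pose I : set (measurableTypeR R) := `[-1, 1]%classic.
have mI : measurable I by exact: measurable_itv.
have mII : measurable (I `*` I) by exact: measurableX.
have e : mu I = 2%:E by rewrite itv_measureE; [congr EFin|]; lra.
apply: le_trans (_ : leb2 (I `*` I) <= _)%E; last first.
  rewrite product_measure1E//; apply: (@le_trans _ _ (2%:E * 2%:E)%E).
    by rewrite le_eqVlt; apply/orP; left; apply/eqP; congr (_ * _)%E; exact: e.
  by rewrite -EFinM lee_fin; lra.
have sub : (@body R : set plane) `<=` I `*` I.
  move=> z /ltW/sublevel_box[h1 h2].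
  by split; rewrite /I/= in_itv/= -ler_norml.
by apply: (le_measure leb2 _ _ sub); rewrite inE//; exact: body_measurable.
Qed.

Lemma plane_wave_continuous a b t : continuous (fun z : R * R => cos (a * z.1 + b * z.2 + t)).
Proof.
move=> z; apply: (@continuous_comp _ _ _ (fun z : R * R => a * z.1 + b * z.2 + t) (@cos R)).
  apply: cvgD; last exact: cvg_cst.
  by apply: cvgD; apply: cvgM; by [exact: cvg_cst|exact: cvg_fst|exact: cvg_snd].
exact: continuous_cos.
Qed.

Lemma plane_wave_measurable a b t :
  measurable_fun (setT : set plane) (fun z => cos (a * z.1 + b * z.2 + t)).
Proof. by apply: continuous_plane_measurable; exact: plane_wave_continuous. Qed.

Lemma integrable_body (h : plane -> R) (M : R) :
  measurable_fun setT h -> (forall z, `|h z| <= M) ->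
  leb2.-integrable (@body R : set plane) (EFin \o h).
Proof.
move=> mh hM; apply: (@integrable_bounded _ _ _ _ _ _ M) => //.
- exact: body_measurable.
- by apply: le_lt_trans body_measure_le _; rewrite ltry.
- exact: measurable_funTS.
Qed.

Lemma wave_integrable a b t : leb2.-integrable (@body R : set plane)
  (EFin \o (fun z => cos (a * z.1 + b * z.2 + t))).
Proof.
by apply: (@integrable_body _ 1); [exact: plane_wave_measurable|move=> z; exact: cos_max].
Qed.

(** The phases t = 0 and t = pi / 2 give the real and imaginary parts of the transform at (a, b), so
    all estimates are made for real integrals. *)
Definition wave a b t : R := \int[leb2]_(z in (@body R : set plane)) cos (a * z.1 + b * z.2 + t).

Definition wave_density a b t z : \bar R :=
  ((fun z => (cos (a * z.1 + b * z.2 + t))%:E) \_ (@body R)) z.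

Lemma waveE a b t : wave a b t = fine (\int[leb2]_z wave_density a b t z)%E.
Proof. by rewrite /wave /Rintegral integral_mkcond. Qed.

Lemma wave_density_integrable a b t : leb2.-integrable (setT : set plane) (wave_density a b t).
Proof.
apply/(integrable_mkcond _ _).1; first exact: body_measurable.
exact: wave_integrable.
Qed.

Lemma wave_density_swap a b t x y : wave_density a b t (x, y) = wave_density b a t (y, x).
Proof.
rewrite /wave_density !patchE; have -> : ((x, y) \in @body R) = ((y, x) \in @body R).
  by rewrite /body; apply/idP/idP; rewrite !inE/= addrC.
by case: ifP => // _ /=; rewrite addrAC [in RHS]addrAC; congr (cos _)%:E; ring.
Qed.

Lemma wave_swap a b t : wave a b t = wave b a t.
Proof.
rewrite !waveE; congr fine.
rewrite -(integral12_prod_meas1 (wave_density_integrable a b t)).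
rewrite -(integral21_prod_meas1 (wave_density_integrable b a t)).
apply: eq_integral => x _; apply: eq_integral => y _.
exact: wave_density_swap.
Qed.

Lemma body_slice x y : body (x, y) <-> `|x| < 1 /\ `|y| < H x.
Proof.
rewrite /body /=; split=> [|[x1]].
  move=> bxy; have x1 : `|x| < 1.
    rewrite -[ltRHS]normr1 -profile_ltE.
    have : f 0 <= f y by rewrite profile_leE normr0.
    by move: bxy; rewrite /level; lra.
  have [h0 h] := heightP (ltW x1); split=> //.
  by rewrite -[ltRHS](ger0_norm h0) -profile_ltE; lra.
have [h0 h] := heightP (ltW x1).
by rewrite -{1}(ger0_norm h0) -profile_ltE; lra.
Qed.

Lemma wave_inner a b t x : b != 0 -> `|x| < 1 ->
  (\int[mu]_y wave_density a b t (x, y) =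
  ((sin (b * H x + (a * x + t)) - sin (b * (- H x) + (a * x + t))) / b)%:E)%E.
Proof.
move=> b0 x1; have h0 := height_gt0 x1.
have -> : (fun y => wave_density a b t (x, y)) =
    (fun y => (cos (b * y + (a * x + t)))%:E) \_ `](- H x), (H x)[.
  apply/funext => y; rewrite /wave_density !patchE.
  have -> : ((x, y) \in @body R) = (y \in (`](- H x), (H x)[%classic : set R)).
    apply/idP/idP; rewrite !inE/= in_itv/= -ltr_norml.
      by move=> /body_slice[].
    by move=> yh; apply/body_slice.
  by case: ifP => // _ /=; congr (cos _)%:E; ring.
rewrite -integral_mkcond.
have mc : measurable_fun `](- H x), (H x)[ (fun y => (cos (b * y + (a * x + t)))%:E).
  by apply/measurable_EFinP/measurable_funTS; exact: affine_cos_measurable.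
rewrite -(integral_itv_bndoo true false)// integral_cos//; lra.
Qed.

(** The vertical slice is integrated explicitly. The phase shift by pi / 2 turns the sines into
    cosines, and the lower arc becomes the upper one with -b in place of b. *)
Lemma wave_formula a b t : b != 0 ->
  wave a b t = (\int[mu]_(x in `]-1, 1[) cos (a * x + b * H x + (t - pi / 2)) -
                \int[mu]_(x in `]-1, 1[) cos (a * x + (- b) * H x + (t - pi / 2))) / b.
Proof.
move=> b0; rewrite waveE -(integral12_prod_meas1 (wave_density_integrable a b t)).
have mI : measurable (`]-1, 1[%classic : set (measurableTypeR R)) by exact: measurable_itv.
have ic c v : mu.-integrable (`]-1, 1[%classic : set (measurableTypeR R))
    (EFin \o (fun x => cos (a * x + c * H x + v))).
  apply: (@integrable_bounded _ _ _ _ _ _ 1) => //.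
  - apply: le_lt_trans (ltry 2%R); rewrite le_eqVlt; apply/orP; left; apply/eqP.
    exact: unit_itv_measure.
  - exact: cos_height_measurable.
  - by move=> x _; exact: cos_max.
rewrite -RintegralB// -RintegralZr//; last first.
  have := @integrableB _ _ _ mu _ mI _ _ (ic b (t - pi / 2)) (ic (- b) (t - pi / 2)).
  by apply: eq_integrable => // x _; rewrite /= EFinB.
rewrite Rintegral_mkcond /Rintegral; congr fine.
apply: eq_integral => x _ /=; rewrite /fubini_F patchE.
case: ifPn => [|nx].
  rewrite inE/= in_itv/= -ltr_norml => x1.
  rewrite wave_inner//; congr (_ / _)%:E.
  by rewrite !addrA !cosBpihalf; congr (sin _ - sin _); ring.
rewrite -[RHS](@integral0 _ _ _ mu setT); apply: eq_integral => y _.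
rewrite /wave_density patchE; case: ifPn => //; rewrite inE => /body_slice[x1 _].
by move: nx; rewrite notin_setE/= in_itv/= -ltr_norml x1.
Qed.

Lemma wave_bound n : exists s : nat * nat -> R, forall a b t, b != 0 ->
  `|wave a b t| <= `|b|^-1 * \sum_(i <- cells n)
    (decay (a + s i * b) + decay (a - s i * b) + 4 * `|b| * flatness n).
Proof.
have [s Hs] := @cos_height_bound R n; exists s => a b t b0.
rewrite wave_formula// normrM normfV mulrC ler_pM2l ?invr_gt0 ?normr_gt0//.
apply: le_trans (ler_normB _ _) _.
apply: le_trans (lerD (Hs a b _) (Hs a (- b) _)) _.
rewrite -big_split /=; apply: ler_sum => i _.
rewrite normrN mulrN.
by have := mulr_ge0 (normr_ge0 b) (ltW (@flatness_gt0 R n)); lra.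
Qed.

Lemma wave_le4 a b t : `|wave a b t| <= 4.
Proof.
apply: le_trans (le_normr_Rintegral _ (wave_integrable a b t)) _.
  exact: body_measurable.
apply: (@le_trans _ _ (\int[leb2]_(z in (@body R : set plane)) 1)).
  apply: le_Rintegral.
  - exact: body_measurable.
  - exact: integrable_norm (wave_integrable a b t).
  - apply: (@integrable_body (fun=> 1) 1) => // z; by rewrite normr1.
  - by move=> z _; exact: cos_max.
rewrite Rintegral_cst ?mul1r; last exact: body_measurable.
have h : fine (leb2 (@body R : set plane)) <= 4.
  by have := body_measure_le; case: (leb2 (@body R : set plane)) => [r||] //=.
exact: h.
Qed.

End Wave.

(** * Powers of sums and the choice of the level *)

Section PowerEstimates.
Context {R : realType}.
Implicit Types (p q b e : R).

(** A sum is at most its length times its largest term. The exponent p on the length is not optimal,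
    but a power of the number of cells costs nothing. *)
Lemma powR_sum_le (I : Type) (r : seq I) (F : I -> R) p : 0 < p ->
  (forall i, 0 <= F i) ->
  (\sum_(i <- r) F i) `^ p <= (size r)%:R `^ p * \sum_(i <- r) F i `^ p.
Proof.
move=> p0 F0.
have [M [M0 FM MF]] : exists M, [/\ 0 <= M, \sum_(i <- r) F i <= (size r)%:R * M &
    M `^ p <= \sum_(i <- r) F i `^ p].
  elim: r => [|a r [M [M0 FM MF]]].
    by exists 0; rewrite !big_nil powR0 ?gt_eqF// mulr0.
  exists (Num.max (F a) M); rewrite !big_cons le_max F0; split=> //.
    rewrite /= -natr1 mulrDl mul1r addrC; apply: lerD; last by rewrite le_max lexx.
    by apply: le_trans FM _; rewrite ler_wpM2l// le_max lexx orbT.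
  have S0 : 0 <= \sum_(i <- r) F i `^ p by apply: sumr_ge0 => i _; exact: powR_ge0.
  have := powR_ge0 (F a) p; case: (leP M (F a)) => _; lra.
apply: (@le_trans _ _ (((size r)%:R * M) `^ p)).
  apply: ge0_ler_powR; rewrite ?nnegrE ?mulr_ge0//; first exact: ltW.
  exact: sumr_ge0.
by rewrite powRM// ler_wpM2l// powR_ge0.
Qed.

Lemma powR_add3_le p x y z : 0 < p -> 0 <= x -> 0 <= y -> 0 <= z ->
  (x + y + z) `^ p <= 3 `^ p * (x `^ p + y `^ p + z `^ p).
Proof.
move=> p0 x0 y0 z0.
have := @powR_sum_le _ [:: x; y; z] (fun t => Num.max 0 t) p p0.
rewrite !big_cons !big_nil !addr0 !(max_idPr _)// !addrA; apply => i.
by rewrite le_max lexx.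
Qed.

(* [9 ^+ n] (up to a constant, the number of cells) grows geometrically, while the
   frequencies [b] admissible at level [n] grow factorially. *)
Lemma level_choice (c e : R) : 0 < c -> 0 < e -> exists2 C : R, 0 < C & forall b, 1 <= b ->
  exists n, 9 ^+ n <= C * b `^ e /\ c * (b ^+ 2 * (3 ^+ n * gap n)) <= 1.
Proof.
(* With this X, 9^m equals (X^m)^(e/2), and X^m is controlled by m! through the exponential
   series. *)
move=> cp e0; pose X : R := 9 `^ (2 / e).
have X0 : 0 <= X by exact: powR_ge0.
have c0 : 0 < c * expR X by rewrite mulr_gt0 ?expR_gt0.
have P0 : 0 <= 9 * (c * expR X) `^ (e / 2) by rewrite mulr_ge0 ?ler0n ?powR_ge0.
exists (1 + 9 * (c * expR X) `^ (e / 2)); first by lra.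
move=> b b1; have b0 : 0 < b by lra.
have bb : c * b ^+ 2 <= (Num.truncn (c * b ^+ 2)).+1%:R by rewrite ltW// truncnS_gt.
have ex : exists n, c * b ^+ 2 <= n`!%:R.
  exists (Num.truncn (c * b ^+ 2)).+1; apply: le_trans bb _.
  by rewrite ler_nat fact_geq.
have [n nP nmin] := ex_minnP ex.
exists n; split; last first.
  have h : 3 ^+ n * gap n <= (n`!%:R)^-1 :> R.
    rewrite /gap invfM mulrA ler_piMl ?invr_ge0//.
    by rewrite ler_pdivrMr ?exprn_gt0// mul1r lerXn2r ?nnegrE//; lra.
  have n0 : 0 < n`!%:R :> R by rewrite ltr0n fact_gt0.
  apply: (@le_trans _ _ (c * (b ^+ 2 * (n`!%:R)^-1))).
    by rewrite ler_wpM2l ?(ltW cp)// ler_wpM2l// sqr_ge0.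
  by rewrite mulrA ler_pdivrMr// mul1r.
(* For n = m + 1, minimality bounds m! by c b^2; the missing step accounts for the factor 9 in the
   constant. *)
case: n nP nmin => [|m] nP nmin.
  rewrite expr0; apply: (@le_trans _ _ (1 * b `^ e)); last first.
    by rewrite ler_wpM2r ?powR_ge0//; lra.
  by rewrite mul1r -[leLHS](powRr0 b) ler_powR// ltW.
have mb : m`!%:R < c * b ^+ 2.
  by rewrite ltNge; apply/negP => /nmin; rewrite ltnn.
have Xm : X ^+ m <= c * expR X * b ^+ 2.
  have m0 : 0 < m`!%:R :> R by rewrite ltr0n fact_gt0.
  have h : X ^+ m <= m`!%:R * expR X.
    rewrite mulrC -ler_pdivrMr//; case: (m) => [|k].
      by rewrite expr0 fact0 divr1; have := expR_ge1Dx X; lra.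
    by have := expR_ge1Dxn k X0; lra.
  by apply: le_trans h _; rewrite mulrAC ler_pM2r ?expR_gt0// ltW.
apply: (@le_trans _ _ (9 * (c * expR X) `^ (e / 2) * b `^ e)); last first.
  by rewrite ler_wpM2r ?powR_ge0//; lra.
rewrite exprS -mulrA ler_pM2l ?ltr0n//.
have -> : 9 ^+ m = (X ^+ m) `^ (e / 2) :> R.
  rewrite -[X ^+ m]powR_mulrn// /X -!powRrM -powR_mulrn ?ler0n//.
  by congr (_ `^ _); field; rewrite gt_eqF.
have -> : b `^ e = (b ^+ 2) `^ (e / 2).
  by rewrite -powR_mulrn ?(ltW b0)// -powRrM; congr (_ `^ _); field.
rewrite -powRM ?sqr_ge0 ?(ltW c0)//.
apply: ge0_ler_powR; rewrite ?nnegrE => //.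
- by lra.
- exact: exprn_ge0.
- by rewrite mulr_ge0 ?sqr_ge0 ?(ltW c0).
Qed.

End PowerEstimates.

Section SliceIntegral.
Context {R : realType}.
Implicit Types (p q a b t : R) (n : nat).

Local Notation mu := (@lebesgue_measure R).
Local Notation plane := (measurableTypeR R * measurableTypeR R)%type.
Local Notation leb2 := (@lebesgue_measure R \x @lebesgue_measure R)%E.

(** Adding 1 to the cosine makes the kernel nonnegative, so that Tonelli yields measurability; the
    area of the body is subtracted afterwards. *)
Lemma wave_measurable t : measurable_fun (setT : set plane) (fun w => wave w.1 w.2 t).
Proof.
pose k (u : plane * plane) : \bar R :=
  ((1 + cos (u.1.1 * u.2.1 + u.1.2 * u.2.2 + t)) * \1_(@body R) u.2)%:E.
have mk : measurable_fun setT k.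
  apply/measurable_EFinP; apply: measurable_funM; last first.
    apply: (@measurableT_comp _ _ _ _ plane _ (\1_(@body R) : plane -> R)).
      by apply: measurable_indic; exact: body_measurable.
    exact: measurable_snd.
  apply: measurable_funD => //; apply: (@measurableT_comp _ _ _ _ _ _ (@cos R)).
    by apply: continuous_measurable_fun; exact: continuous_cos.
  apply: measurable_funD => //; apply: measurable_funD; apply: measurable_funM.
  - exact: (measurableT_comp measurable_fst measurable_fst).
  - exact: (measurableT_comp measurable_fst measurable_snd).
  - exact: (measurableT_comp measurable_snd measurable_fst).
  - exact: (measurableT_comp measurable_snd measurable_snd).
have k0 u : (0 <= k u)%E.
  by rewrite lee_fin mulr_ge0// -lerBlDl sub0r cos_geN1.
have mF := measurable_fun_fubini_tonelli_F (m2 := @plane_measure R) k mk k0.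
have -> : (fun w : plane => wave w.1 w.2 t) =
    fun w => fine (fubini_F (@plane_measure R) k w) - fine (leb2 (@body R : set plane)).
  apply/funext => w; rewrite /wave.
  have i1 : leb2.-integrable (@body R : set plane) (EFin \o cst (1 : R)).
    by apply: (@integrable_body _ _ 1) => // z; rewrite normr1.
  have i2 := wave_integrable w.1 w.2 t.
  have -> : fine (fubini_F (@plane_measure R) k w) = \int[leb2]_(z in (@body R : set plane))
      (1 + cos (w.1 * z.1 + w.2 * z.2 + t)).
    rewrite Rintegral_mkcond /Rintegral /fubini_F; congr fine.
    apply: eq_integral => z _; rewrite /k patchE indicE.
    by case: ifP => _; rewrite ?mulr1 ?mulr0.
  rewrite RintegralD//; last exact: body_measurable.
  rewrite Rintegral_cst; last exact: body_measurable.
  by rewrite mul1r; lra.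
apply: measurable_funB => //.
by apply: (@measurableT_comp _ _ _ _ _ _ fine).
Qed.

Definition wave_norm (w : R * R) : R := `|wave w.1 w.2 0| + `|wave w.1 w.2 (pi / 2)|.

Lemma wave_norm_ge0 w : 0 <= wave_norm w.
Proof. exact: addr_ge0. Qed.

Lemma wave_norm_le8 w : wave_norm w <= 8.
Proof.
by have := wave_le4 w.1 w.2 0; have := wave_le4 w.1 w.2 (pi / 2); rewrite /wave_norm; lra.
Qed.

Lemma wave_norm_swap a b : wave_norm (a, b) = wave_norm (b, a).
Proof. by rewrite /wave_norm /= !(wave_swap a b). Qed.

Lemma wave_norm_measurable : measurable_fun (setT : set plane) wave_norm.
Proof.
by apply: measurable_funD; apply: measurableT_comp => //; exact: wave_measurable.
Qed.

Lemma wave_norm_pow_measurable p :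
  measurable_fun (setT : set plane) (fun w => wave_norm w `^ p).
Proof.
apply: (@measurableT_comp _ _ _ _ _ _ (fun y : R => y `^ p)); last exact: wave_norm_measurable.
exact: measurable_powR.
Qed.

Lemma wave_norm_pow_bound n p : 0 < p -> exists s : nat * nat -> R, forall a b, b != 0 ->
  wave_norm (a, b) `^ p <= (6 / `|b| * (size (cells n))%:R) `^ p *
    \sum_(i <- cells n) (decay (a + s i * b) `^ p + decay (a - s i * b) `^ p +
                         (4 * `|b| * flatness n) `^ p).
Proof.
move=> p0; have [s Hs] := @wave_bound R n; exists s => a b b0.
have b1 : 0 < `|b| by rewrite normr_gt0.
set E := 4 * `|b| * flatness n.
have E0 : 0 <= E.
  by rewrite mulr_ge0 ?(ltW (flatness_gt0 _))// mulr_ge0.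
pose G i := decay (a + s i * b) + decay (a - s i * b) + E.
have G0 i : 0 <= G i by rewrite !addr_ge0// ltW// decay_gt0.
have S0 : 0 <= \sum_(i <- cells n) G i by apply: sumr_ge0.
have h : wave_norm (a, b) <= 2 / `|b| * \sum_(i <- cells n) G i.
  have := Hs a b 0 b0; have := Hs a b (pi / 2) b0.
  by rewrite /wave_norm /= -/E /G; lra.
apply: (@le_trans _ _ ((2 / `|b| * \sum_(i <- cells n) G i) `^ p)).
  apply: ge0_ler_powR; rewrite ?nnegrE ?wave_norm_ge0//; first exact: ltW.
  by rewrite mulr_ge0// divr_ge0.
(* The 6 is 2 for the two phases in [wave_norm] times 3 for the three summands of each cell. *)
have -> : 6 / `|b| * (size (cells n))%:R = 2 / `|b| * (3 * (size (cells n))%:R) by lra.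
have c0 : 0 <= 2 / `|b| by rewrite divr_ge0.
have k0 : 0 <= (size (cells n))%:R :> R by [].
have k3 : 0 <= 3 * (size (cells n))%:R :> R by rewrite mulr_ge0.
rewrite (powRM _ c0 S0) (powRM _ c0 k3) -mulrA ler_wpM2l ?powR_ge0//.
apply: le_trans (powR_sum_le _ p0 G0) _.
rewrite (powRM _ _ k0)// -mulrA mulrCA ler_wpM2l ?powR_ge0// mulr_sumr.
apply: ler_sum => i _; apply: powR_add3_le => //; exact/ltW/decay_gt0.
Qed.

Definition symitv b : set R := `[- `|b|, `|b|]%classic.

Lemma symitv_measure b : mu (symitv b) = (2 * `|b|)%:E.
Proof. by rewrite itv_measureE; [congr EFin; lra|have := normr_ge0 b; lra]. Qed.

Lemma cell_integral p : 1 < p -> exists2 C : R, 0 <= C & forall u v b E : R, 0 <= E ->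
  (\int[mu]_(a in symitv b)
     (decay (a + u) `^ p + decay (a + v) `^ p + E `^ p)%:E <=
   (C + E `^ p * (2 * `|b|))%:E)%E.
Proof.
move=> p1; have [C HC] := @decay_integral R p p1.
have C0 : 0 <= C.
  rewrite -lee_fin; apply: le_trans (HC 0); apply: integral_ge0 => a _.
  by rewrite lee_fin powR_ge0.
exists (C + C); first by rewrite addr_ge0.
move=> u v b E E0; set I := symitv b.
have mI : measurable (I : set (measurableTypeR R)) by exact: measurable_itv.
have md w : measurable_fun (setT : set (measurableTypeR R))
    (fun a => (decay (a + w) `^ p)%:E).
  apply/measurable_EFinP; apply: (@measurableT_comp _ _ _ _ _ _ (fun y : R => y `^ p)).
    exact: measurable_powR.
  exact: decay_measurable.
have hI w : (\int[mu]_(a in I) (decay (a + w) `^ p)%:E <= C%:E)%E.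
  apply: le_trans (HC w); apply: ge0_subset_integral => //.
  by move=> a _; rewrite lee_fin powR_ge0.
under eq_integral do rewrite 2!EFinD.
have P0 w a : (0 <= (decay (a + w) `^ p)%:E)%E by rewrite lee_fin powR_ge0.
have mdI w : measurable_fun (I : set (measurableTypeR R)) (fun a => (decay (a + w) `^ p)%:E)
  := measurable_funTS (md w).
rewrite ge0_integralD => [|//|a _||a _|]; last 4 first.
- by rewrite adde_ge0.
- exact: emeasurable_funD.
- by rewrite lee_fin powR_ge0.
- exact: measurable_cst.
rewrite ge0_integralD => [|//|//|//|//|//].
rewrite [in leRHS]EFinD [in leRHS]EFinD; apply: leeD; first exact: leeD.
rewrite integral_cst// EFinM; apply: lee_wpmul2l; first by rewrite lee_fin powR_ge0.
by rewrite le_eqVlt; apply/orP; left; apply/eqP; exact: symitv_measure.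
Qed.

End SliceIntegral.

Section LpBound.
Context {R : realType}.
Implicit Types (p q a b t : R) (n : nat).

Local Notation mu := (@lebesgue_measure R).
Local Notation plane := (measurableTypeR R * measurableTypeR R)%type.
Local Notation leb2 := (@lebesgue_measure R \x @lebesgue_measure R)%E.

Lemma size_cells n : (size (cells n))%:R = 4 * 9 ^+ n :> R.
Proof.
rewrite size_allpairs size_iota !natrM natrX.
have -> : 9 = 3 * 3 :> R by ring.
by rewrite exprMn; ring.
Qed.

Lemma symitv_measurable b : @measurable _ (measurableTypeR R) (symitv b).
Proof. exact: measurable_itv. Qed.

Lemma wave_norm_slice_measurable p b :
  measurable_fun (setT : set (measurableTypeR R)) (fun a => (wave_norm (a, b) `^ p)%:E).
Proof.
apply/measurable_EFinP.
exact: (measurable_fun_pair1 b (wave_norm_pow_measurable p)).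
Qed.

Lemma slice_integral_const p (M : R) b : 0 <= M -> (forall a, wave_norm (a, b) `^ p <= M) ->
  (\int[mu]_(a in symitv b) (wave_norm (a, b) `^ p)%:E <= (M * (2 * `|b|))%:E)%E.
Proof.
move=> M0 HM; apply: (@le_trans _ _ (\int[mu]_(a in symitv b) (cst M%:E) a)%E).
  apply: ge0_le_integral => //; first exact: symitv_measurable.
  - by move=> a _; rewrite lee_fin powR_ge0.
  - exact: measurable_funTS (wave_norm_slice_measurable p b).
  - by move=> a _; rewrite lee_fin.
rewrite integral_cst; last exact: symitv_measurable.
rewrite EFinM; apply: lee_wpmul2l; first by rewrite lee_fin.
by rewrite le_eqVlt; apply/orP; left; apply/eqP; exact: symitv_measure.
Qed.

Lemma slice_integral_step p : 1 < p -> exists2 C : R, 0 <= C & forall n b, b != 0 ->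
  (\int[mu]_(a in symitv b) (wave_norm (a, b) `^ p)%:E <=
  ((6 / `|b| * (size (cells n))%:R) `^ p * ((size (cells n))%:R *
     (C + (4 * `|b| * flatness n) `^ p * (2 * `|b|))))%:E)%E.
Proof.
move=> p1; have p0 : 0 < p by lra.
have [C C0 HC] := cell_integral p1; exists C => // n b b0.
have [s Hs] := @wave_norm_pow_bound R n p p0.
set E := 4 * `|b| * flatness n; set K := (6 / _ * _) `^ p.
have E0 : 0 <= E by rewrite mulr_ge0 ?(ltW (flatness_gt0 _))// mulr_ge0.
have K0 : 0 <= K by exact: powR_ge0.
pose G (i : nat * nat) a : \bar R :=
  (decay (a + s i * b) `^ p + decay (a + - (s i * b)) `^ p + E `^ p)%:E.
have G0 i a : (0 <= G i a)%E by rewrite lee_fin !addr_ge0// powR_ge0.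
have mG i : measurable_fun (symitv b : set (measurableTypeR R)) (G i).
  have md w : measurable_fun (setT : set (measurableTypeR R)) (fun a => decay (a + w) `^ p).
    apply: (@measurableT_comp _ _ _ _ _ _ (fun y : R => y `^ p)).
      exact: measurable_powR.
    exact: decay_measurable.
  apply/measurable_EFinP/measurable_funTS; apply: measurable_funD => //.
  by apply: measurable_funD; exact: md.
apply: (@le_trans _ _ (\int[mu]_(a in symitv b) (K%:E * \sum_(i <- cells n) G i a))%E).
  apply: ge0_le_integral; first exact: symitv_measurable.
  - by move=> a _; rewrite lee_fin powR_ge0.
  - exact: measurable_funTS (wave_norm_slice_measurable p b).
  - by apply: measurable_funeM; exact: emeasurable_sum.
  - by move=> a _; rewrite sumEFin -EFinM lee_fin; exact: Hs.
rewrite ge0_integralZl//; first last.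
- by move=> a _; exact: sume_ge0.
- exact: emeasurable_sum.
- exact: symitv_measurable.
rewrite ge0_integral_sum//; last exact: symitv_measurable.
rewrite [leRHS]EFinM; apply: lee_wpmul2l => //.
apply: (@le_trans _ _ (\sum_(i <- cells n) (C + E `^ p * (2 * `|b|))%:E)%E).
  by apply: lee_sum => i _; exact: HC.
by rewrite sumEFin lee_fin big_const_seq count_predT iter_addr_0 -[leLHS]mulr_natl lexx.
Qed.

Lemma slice_integral p : 1 < p -> exists2 C : R, 0 <= C & forall b,
  (\int[mu]_(a in symitv b) (wave_norm (a, b) `^ p)%:E <=
   (C * decay (b + 0) `^ ((1 + p) / 2))%:E)%E.
Proof.
move=> p1; set q := (1 + p) / 2; have p0 : 0 < p by lra.
have [C C0 HC] := slice_integral_step p1.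
(* The number of cells enters with exponent p + 1, so this choice costs |b|^(p-q) in total and
   leaves |b|^(-q) of the factor |b|^(-p). *)
have e0 : 0 < (p - q) / (p + 1) by rewrite divr_gt0 /q; lra.
(* The constant is 256 = 4 * 64, with 64 from [flatness]: the error term is then at most 1 / |b|,
   and its p-th power integrates to at most 2 over the slice. *)
have [C1 C10 HC1] := @level_choice R 256 _ (ltr0n _ 256) e0.
pose C2 := 6 `^ p * (4 * C1) `^ (p + 1) * (C + 2).
have C20 : 0 <= C2 by rewrite mulr_ge0 ?mulr_ge0 ?powR_ge0//; lra.
have C30 : 0 <= 8 `^ p * 2 :> R by rewrite mulr_ge0 ?powR_ge0.
exists (8 `^ p * 2 + C2); first lra.
move=> b; rewrite addr0; have [b1|b1] := ltP `|b| 1.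
  have h a : wave_norm (a, b) `^ p <= 8 `^ p.
    apply: ge0_ler_powR; rewrite ?nnegrE ?wave_norm_ge0 ?wave_norm_le8//; lra.
  apply: le_trans (slice_integral_const (powR_ge0 _ _) h) _.
  rewrite lee_fin; apply: (@le_trans _ _ (8 `^ p * 2)).
    by rewrite ler_wpM2l ?powR_ge0//; lra.
  rewrite -[leLHS]mulr1; apply: ler_pM => //; first by lra.
  rewrite /decay (max_idPl (ltW b1)) divr1 -[leLHS](powRr0 2) ler_powR//; last by rewrite /q; lra.
  by lra.
have b0 : 0 < `|b| by lra.
have bn0 : b != 0 by rewrite -normr_gt0.
have [n [n9 nE]] := HC1 _ b1.
apply: le_trans (HC n _ bn0) _; rewrite lee_fin.
set E := 4 * `|b| * flatness n; set K : R := (size (cells n))%:R.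
have E0 : 0 <= E by rewrite mulr_ge0 ?(ltW (flatness_gt0 _))// mulr_ge0.
have Eb : E <= `|b|^-1.
  rewrite -[leRHS]mul1r ler_pdivlMr//; apply: le_trans nE.
  by rewrite /E /flatness le_eqVlt; apply/orP; left; apply/eqP; ring.
have bi1 : 0 < `|b|^-1 <= 1 by rewrite invr_gt0 b0 invf_le1.
have Ep : E `^ p * (2 * `|b|) <= 2.
  have h : E `^ p <= `|b|^-1.
    apply: (@le_trans _ _ (`|b|^-1 `^ p)).
      by apply: ge0_ler_powR; rewrite ?nnegrE ?invr_ge0//; lra.
    by apply: ge1r_powR => //; lra.
  have := ler_wpM2r (ltW b0) h; rewrite mulVf ?gt_eqF//; lra.
have K0 : 0 <= K by rewrite ler0n.
have KC : K <= 4 * C1 * `|b| `^ ((p - q) / (p + 1)).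
  by rewrite /K size_cells -mulrA ler_pM2l.
have Kp : K `^ (p + 1) <= (4 * C1) `^ (p + 1) * `|b| `^ (p - q).
  have c4 : 0 <= 4 * C1 by rewrite mulr_ge0 ?(ltW C10).
  apply: (@le_trans _ _ ((4 * C1 * `|b| `^ ((p - q) / (p + 1))) `^ (p + 1))).
    by apply: ge0_ler_powR; rewrite ?nnegrE ?mulr_ge0 ?powR_ge0//; lra.
  rewrite powRM ?powR_ge0// -powRrM; apply: ler_wpM2l; first exact: powR_ge0.
  by rewrite (_ : (p - q) / (p + 1) * (p + 1) = p - q)//; field; rewrite gt_eqF//; lra.
have K1 : K `^ p * K = K `^ (p + 1).
  rewrite powRD; first by rewrite powRr1.
  by apply/implyP; rewrite gt_eqF//; lra.
have i0 : 0 <= 6 / `|b| by rewrite divr_ge0.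
have i1 : 0 <= `|b|^-1 by rewrite invr_ge0.
rewrite (powRM _ i0 K0) powRM// -!mulrA.
have -> : 6 `^ p * (`|b|^-1 `^ p * (K `^ p * (K * (C + E `^ p * (2 * `|b|))))) =
    6 `^ p * (`|b|^-1 `^ p * (K `^ (p + 1) * (C + E `^ p * (2 * `|b|)))).
  by rewrite -K1; ring.
apply: (@le_trans _ _ (6 `^ p * (`|b|^-1 `^ p *
  ((4 * C1) `^ (p + 1) * `|b| `^ (p - q) * (C + 2))))).
  apply: ler_wpM2l; first exact: powR_ge0.
  apply: ler_wpM2l; first exact: powR_ge0.
  apply: ler_pM => //; first exact: powR_ge0.
    by rewrite addr_ge0// mulr_ge0 ?powR_ge0// mulr_ge0.
  by rewrite lerD2l.
have bq : `|b|^-1 `^ p * `|b| `^ (p - q) = `|b|^-1 `^ q.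
  rewrite -(powR_inv1 (normr_ge0 b)) -!powRrM -powRD.
    by congr (_ `^ _); ring.
  by rewrite (gt_eqF b0) implybT.
have -> : 6 `^ p * (`|b|^-1 `^ p * ((4 * C1) `^ (p + 1) * `|b| `^ (p - q) * (C + 2))) =
    C2 * (`|b|^-1 `^ p * `|b| `^ (p - q)) by rewrite /C2; ring.
rewrite bq; apply: (@le_trans _ _ (C2 * decay b `^ q)); last first.
  by rewrite ler_wpM2r ?powR_ge0//; lra.
apply: ler_wpM2l => //; apply: ge0_ler_powR; rewrite ?nnegrE//; first by rewrite /q; lra.
  exact/ltW/decay_gt0.
by rewrite /decay (max_idPr b1); lra.
Qed.

End LpBound.

(** * Integration over the plane *)

Section LpTotal.
Context {R : realType}.
Implicit Types (p q a b t : R).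

Local Notation mu := (@lebesgue_measure R).
Local Notation plane := (measurableTypeR R * measurableTypeR R)%type.
Local Notation leb2 := (@lebesgue_measure R \x @lebesgue_measure R)%E.

Definition sector p (w : plane) : \bar R :=
  (if `|w.1| <= `|w.2| then wave_norm w `^ p else 0)%:E.

Lemma sector_ge0 p w : (0 <= sector p w)%E.
Proof. by rewrite lee_fin; case: ifP => // _; exact: powR_ge0. Qed.

Lemma sector_measurable p : measurable_fun setT (sector p).
Proof.
apply/measurable_EFinP; apply: measurable_fun_ifT => //.
  apply: measurable_fun_ler.
    by apply: measurableT_comp => //; exact: measurable_fst.
  by apply: measurableT_comp => //; exact: measurable_snd.
exact: wave_norm_pow_measurable.
Qed.

Lemma sector_slice p b :
  (\int[mu]_a sector p (a, b) = \int[mu]_(a in symitv b) (wave_norm (a, b) `^ p)%:E)%E.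
Proof.
rewrite [RHS]integral_mkcond; apply: eq_integral => a _.
rewrite /sector patchE /=.
have -> : (a \in symitv b) = (`|a| <= `|b|).
  by apply/idP/idP; rewrite inE /symitv /= in_itv/= -ler_norml.
by case: ifP.
Qed.

Lemma sector_double p : 1 < p -> (\int[mu]_b \int[mu]_a sector p (a, b) < +oo)%E.
Proof.
move=> p1; have [C C0 HC] := slice_integral p1; set q := (1 + p) / 2 in HC.
have q1 : 1 < q by rewrite /q; lra.
have [C' HC'] := @decay_integral R q q1.
have md : measurable_fun (setT : set (measurableTypeR R)) (fun b => (decay (b + 0) `^ q)%:E).
  apply/measurable_EFinP; apply: (@measurableT_comp _ _ _ _ _ _ (fun y : R => y `^ q)).
    exact: measurable_powR.
  exact: decay_measurable.
apply: (@le_lt_trans _ _ (\int[mu]_b (C%:E * (decay (b + 0) `^ q)%:E))%E).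
  apply: ge0_le_integral => //.
  - by move=> b _; apply: integral_ge0 => a _; exact: sector_ge0.
  - apply: (measurable_fun_fubini_tonelli_G (m1 := mu) (sector p)).
      exact: sector_measurable.
    exact: sector_ge0.
  - exact: measurable_funeM.
  - by move=> b _; rewrite sector_slice -EFinM.
rewrite ge0_integralZl//; last by move=> b _; rewrite lee_fin powR_ge0.
apply: le_lt_trans (_ : C%:E * C'%:E < +oo)%E; last by rewrite -EFinM ltry.
by apply: lee_wpmul2l => //; exact: HC'.
Qed.

(** The sector and its mirror image cover the plane. Tonelli is applied in opposite orders to the
    two, which leads to the same iterated integral. *)
Lemma wave_norm_Lp p : 1 < p -> (\int[leb2]_w (wave_norm w `^ p)%:E < +oo)%E.
Proof.
move=> p1; have D := sector_double p1.
pose sw (w : plane) : \bar R := sector p (w.2, w.1).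
have msw : measurable_fun setT sw.
  apply: (measurableT_comp (sector_measurable p)).
  by apply: measurable_fun_pair; [exact: measurable_snd|exact: measurable_fst].
apply: (@le_lt_trans _ _ (\int[leb2]_w (sector p w + sw w))%E).
  apply: ge0_le_integral => //.
  - by move=> w _; rewrite lee_fin powR_ge0.
  - by apply/measurable_EFinP; exact: wave_norm_pow_measurable.
  - exact: (emeasurable_funD (sector_measurable p) msw).
  move=> [a b] _; rewrite /sw /sector /= wave_norm_swap -EFinD lee_fin.
  have := powR_ge0 (wave_norm (b, a)) p.
  by case: (leP `|a| `|b|); case: (leP `|b| `|a|); lra.
have sw0 w : (0 <= sw w)%E := sector_ge0 p (w.2, w.1).
rewrite (ge0_integralD leb2 measurableT (fun w _ => sector_ge0 p w) (sector_measurable p)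
  (fun w _ => sw0 w) msw).
have e2 := @fubini_tonelli2 _ _ _ _ R mu mu _ (sector_measurable p) (sector_ge0 p).
have e1 := @fubini_tonelli1 _ _ _ _ R mu mu sw msw sw0.
by apply: lte_add_pinfty; [rewrite e2; exact: D|rewrite e1; exact: D].
Qed.

End LpTotal.

(** * The characteristic function as a distribution *)

Section Distribution.
Local Open Scope complex_scope.
Context {R : realType}.
Implicit Types (t : R) (x w : R * R) (z : R[i]) (phi psi : R * R -> R[i]).

Local Notation plane := (measurableTypeR R * measurableTypeR R)%type.
Local Notation leb2 := (@lebesgue_measure R \x @lebesgue_measure R)%E.
Local Notation chi := (\1_(@body R) : R * R -> R).

Lemma normc_le z : absC z <= `|ReC z| + `|ImC z|.
Proof.
case: z => a b /=; rewrite -(@ger0_norm _ (`|a| + `|b|)) ?addr_ge0// -sqrtr_sqr.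
rewrite ler_wsqrtr// sqrrD !real_normK ?num_real//.
by rewrite lerD2r lerDl mulrn_wge0// mulr_ge0.
Qed.

Lemma normc_ge0 z : 0 <= absC z.
Proof. by case: z => a b; exact: sqrtr_ge0. Qed.

Lemma Re_le_normc z : `|ReC z| <= absC z.
Proof. by case: z => a b /=; rewrite -sqrtr_sqr ler_wsqrtr// lerDl sqr_ge0. Qed.

Lemma Im_le_normc z : `|ImC z| <= absC z.
Proof. by case: z => a b /=; rewrite -sqrtr_sqr ler_wsqrtr// lerDr sqr_ge0. Qed.

Lemma Re_cindic x z : ReC (cindic (@body R) x * z) = chi x * ReC z.
Proof. by case: z => a b; rewrite /cindic /= mul0r subr0. Qed.

Lemma Im_cindic x z : ImC (cindic (@body R) x * z) = chi x * ImC z.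
Proof. by case: z => a b; rewrite /cindic /= mul0r addr0. Qed.

Lemma Rintegral_chi (h : plane -> R) :
  \int[leb2]_x (chi x * h x) = \int[leb2]_(x in (@body R : set plane)) h x.
Proof.
rewrite [RHS]Rintegral_mkcond; apply: eq_Rintegral => x _.
by rewrite indicE patchE; case: ifP => _; rewrite ?mul1r ?mul0r.
Qed.

Lemma fourier_body w :
  fourier (cindic (@body R)) w = wave w.1 w.2 0 +i* wave w.1 w.2 (pi / 2).
Proof.
rewrite /fourier /cintegral; congr (_ +i* _).
  rewrite /wave -Rintegral_chi; apply: eq_Rintegral => x _.
  by rewrite /= mul0r subr0 cosN addr0.
rewrite /wave -Rintegral_chi; apply: eq_Rintegral => x _.
by rewrite /= mul0r addr0 cosDpihalf -sinN.
Qed.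

Lemma fourier_body_le w : absC (fourier (cindic (@body R)) w) <= wave_norm w.
Proof. by rewrite fourier_body; exact: normc_le. Qed.

Lemma cmeasurable_fourier_body : cmeasurable (fourier (cindic (@body R))).
Proof.
split.
  have -> : ReC \o fourier (cindic (@body R)) = fun w => wave w.1 w.2 0.
    by apply/funext => w; exact: (congr1 ReC (fourier_body w)).
  exact: wave_measurable.
have -> : ImC \o fourier (cindic (@body R)) = fun w => wave w.1 w.2 (pi / 2).
  by apply/funext => w; exact: (congr1 ImC (fourier_body w)).
exact: wave_measurable.
Qed.

Lemma fourier_body_Lp (p : \bar R) : (1 < p)%E -> in_Lp p (fourier (cindic (@body R))).
Proof.
move=> p1; split; first exact: cmeasurable_fourier_body.
case: p p1 => [p| |] //=; last first.
  (* For p infinite the uniform bound by the area suffices. *)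
  move=> _; rewrite unlock; case: ifP => _; last by rewrite ltry.
  apply: (@le_lt_trans _ _ 8%:E); last by rewrite ltry.
  apply/ess_supP; apply: aeW => w /=; rewrite lee_fin ger0_norm; last first.
    exact: sqrtr_ge0.
  by apply: le_trans (fourier_body_le w) _; exact: wave_norm_le8.
rewrite lte_fin => p1; rewrite unlock.
apply: poweR_lty; apply: le_lt_trans (wave_norm_Lp p1).
have mn : measurable_fun (setT : set plane)
    (fun w => absC (fourier (cindic (@body R)) w)).
  have [m1 m2] := cmeasurable_fourier_body.
  have -> : (fun w => absC (fourier (cindic (@body R)) w)) = fun w =>
      Num.sqrt ((ReC \o fourier (cindic (@body R))) w ^+ 2 +
                (ImC \o fourier (cindic (@body R))) w ^+ 2).
    by apply/funext => w /=; case: (fourier _ w).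
  apply: (@measurableT_comp _ _ _ _ _ _ (@Num.sqrt R)).
    by apply: continuous_measurable_fun; exact: sqrt_continuous.
  by apply: measurable_funD; apply: measurable_funX.
have a0 w : 0 <= absC (fourier (cindic (@body R)) w) by exact: normc_ge0.
have -> : (\int[leb2]_w (`|(absC (fourier (cindic (@body R)) w))%:E| `^ p) =
    \int[leb2]_w (absC (fourier (cindic (@body R)) w) `^ p)%:E)%E.
  by apply: eq_integral => w _; rewrite /= ger0_norm.
apply: ge0_le_integral => //.
- by move=> w _; rewrite lee_fin powR_ge0.
- apply/measurable_EFinP; apply: (@measurableT_comp _ _ _ _ _ _ (fun y : R => y `^ p)).
    exact: measurable_powR.
  exact: mn.
- by apply/measurable_EFinP; exact: wave_norm_pow_measurable.
move=> w _; rewrite lee_fin; apply: ge0_ler_powR; rewrite ?nnegrE ?wave_norm_ge0//.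
  by lra.
exact: fourier_body_le.
Qed.

Lemma schwartz_continuous phi : schwartz phi ->
  continuous (ReC \o phi) /\ continuous (ImC \o phi).
Proof. by move=> [/(_ [::])[]]. Qed.

Lemma schwartz_decay phi N : schwartz phi -> exists M : R, forall x,
  (1 + `|x|) ^+ N * absC (phi x) <= M /\ (M%:E <= schwartz_norm N phi)%E.
Proof.
move=> [_ /(_ N)]; set S := schwartz_norm N phi => Soo.
have ub x : (((1 + `|x|) ^+ N * absC (phi x))%:E <= S)%E.
  by apply: ereal_sup_ubound; exists [::], x.
exists (fine S) => x; have := ub x; case: S Soo ub => [r| |] //= _ ub h.
Qed.

(** The max norm dominates both coordinates, so (1 + |x|)^(-4) is at most a product of squared
    one-dimensional decays, whose integrals are already known to be finite. *)
Lemma rapid_decay_integrable (h : R * R -> R) (M : R) : continuous h ->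
  (forall x, (1 + `|x|) ^+ 4 * `|h x| <= M) ->
  leb2.-integrable (setT : set plane) (EFin \o h).
Proof.
move=> ch hM.
have mh : measurable_fun (setT : set plane) h by exact: continuous_plane_measurable.
have M0 : 0 <= M by apply: le_trans (hM 0); rewrite mulr_ge0// exprn_ge0// addr_ge0.
apply/integrableP; split; first exact/measurable_EFinP.
pose k (x : plane) : \bar R :=
  (M * (decay (x.1 + 0) `^ 2 * decay (x.2 + 0) `^ 2))%:E.
have d0 (u : R) : 0 <= decay (u + 0) `^ 2 by exact: powR_ge0.
have md : measurable_fun (setT : set (measurableTypeR R)) (fun u => decay (u + 0) `^ 2).
  apply: (@measurableT_comp _ _ _ _ _ _ (fun y : R => y `^ 2)).
    exact: measurable_powR.
  exact: decay_measurable.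
have mk : measurable_fun setT k.
  apply/measurable_EFinP; apply: measurable_funM => //; apply: measurable_funM.
    exact: (measurableT_comp md measurable_fst).
  exact: (measurableT_comp md measurable_snd).
have k0 x : (0 <= k x)%E by rewrite lee_fin mulr_ge0// mulr_ge0.
have le_decay (u y : R) : `|u| <= y -> (1 + y)^-1 <= decay (u + 0).
  move=> uy; have u0 := normr_ge0 u.
  rewrite addr0 /decay -[leLHS]mul1r.
  apply: ler_pM; [by []|by rewrite invr_ge0; lra|by rewrite ler1n|].
  rewrite lef_pV2 ?posrE ?lt_max ?ltr01//; last by lra.
  by rewrite ge_max; apply/andP; split; lra.
have le_decay2 (u y : R) : `|u| <= y -> (1 + y)^-1 ^+ 2 <= decay (u + 0) `^ 2.
  move=> uy; have y0 : 0 <= (1 + y)^-1 by rewrite invr_ge0; have := normr_ge0 u; lra.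
  rewrite -(powR_mulrn _ y0); apply: ge0_ler_powR; rewrite ?nnegrE ?ler0n//.
    exact/ltW/decay_gt0.
  exact: le_decay.
apply: (@le_lt_trans _ _ (\int[leb2]_x k x)%E).
  apply: ge0_le_integral => //.
    by apply/measurable_EFinP; exact: measurableT_comp.
  move=> x _; rewrite /= lee_fin.
  have x0 : 0 < 1 + `|x| by rewrite ltr_pwDl.
  have x1 : `|x.1| <= `|x| by rewrite [leRHS]prod_normE le_max lexx.
  have x2 : `|x.2| <= `|x| by rewrite [leRHS]prod_normE le_max lexx orbT.
  apply: (@le_trans _ _ (M * ((1 + `|x|) ^+ 4)^-1)).
    by rewrite ler_pdivlMr ?exprn_gt0// mulrC.
  apply: ler_wpM2l => //.
  have -> : ((1 + `|x|) ^+ 4)^-1 = (1 + `|x|)^-1 ^+ 2 * (1 + `|x|)^-1 ^+ 2.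
    by rewrite -exprD exprVn.
  by apply: ler_pM; rewrite ?sqr_ge0//; exact: le_decay2.
have [C HC] := @decay_integral R 2 (ltr1n _ 2).
have C0 : 0 <= C.
  rewrite -lee_fin; apply: le_trans (HC 0); apply: integral_ge0 => u _.
  by rewrite lee_fin.
have mE : measurable_fun (setT : set (measurableTypeR R)) (fun u => (decay (u + 0) `^ 2)%:E).
  exact/measurable_EFinP.
have e1 := @fubini_tonelli1 _ _ _ _ R (@lebesgue_measure R) (@lebesgue_measure R) k mk k0.
rewrite e1; apply: (@le_lt_trans _ _ (\int[@lebesgue_measure R]_u
    ((M * C)%:E * (decay (u + 0) `^ 2)%:E))%E).
  apply: ge0_le_integral => //.
  - by move=> u _; apply: integral_ge0.
  - exact: (measurable_fun_fubini_tonelli_F (m2 := @lebesgue_measure R) k mk k0).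
  - exact: measurable_funeM.
  move=> u _; rewrite /fubini_F /k /=.
  under eq_integral do rewrite mulrA EFinM.
  rewrite ge0_integralZl//; last 2 first.
  - by move=> v _; rewrite lee_fin.
  - by rewrite lee_fin mulr_ge0.
  rewrite -[leRHS]EFinM mulrAC [leRHS]EFinM; apply: lee_wpmul2l; first by rewrite lee_fin mulr_ge0.
  exact: HC.
rewrite ge0_integralZl//; last 2 first.
- by move=> v _; rewrite lee_fin.
- by rewrite lee_fin mulr_ge0.
apply: le_lt_trans (_ : (M * C)%:E * C%:E < +oo)%E; last by rewrite -EFinM ltry.
by apply: lee_wpmul2l; [rewrite lee_fin mulr_ge0|exact: HC].
Qed.

End Distribution.

(** * Temperedness and the distributional transform *)

Section Tempered.
Local Open Scope complex_scope.
Context {R : realType}.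
Implicit Types (t : R) (x w : R * R) (z : R[i]) (phi psi : R * R -> R[i]).

Local Notation plane := (measurableTypeR R * measurableTypeR R)%type.
Local Notation leb2 := (@lebesgue_measure R \x @lebesgue_measure R)%E.
Local Notation chi := (\1_(@body R) : R * R -> R).

Lemma schwartz_Re_integrable phi : schwartz phi ->
  leb2.-integrable (setT : set plane) (EFin \o (ReC \o phi)).
Proof.
move=> sphi; have [c1 c2] := schwartz_continuous sphi.
have [M HM] := schwartz_decay 4 sphi; apply: (@rapid_decay_integrable _ _ M) => // x.
apply: le_trans (proj1 (HM x)); rewrite ler_wpM2l ?exprn_ge0 ?addr_ge0//.
exact: Re_le_normc.
Qed.

Lemma schwartz_Im_integrable phi : schwartz phi ->
  leb2.-integrable (setT : set plane) (EFin \o (ImC \o phi)).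
Proof.
move=> sphi; have [c1 c2] := schwartz_continuous sphi.
have [M HM] := schwartz_decay 4 sphi; apply: (@rapid_decay_integrable _ _ M) => // x.
apply: le_trans (proj1 (HM x)); rewrite ler_wpM2l ?exprn_ge0 ?addr_ge0//.
exact: Im_le_normc.
Qed.

Lemma integrable_cos_mul (h : plane -> R) (k : plane -> R) :
  leb2.-integrable setT (EFin \o h) -> measurable_fun setT k -> (forall x, `|k x| <= 1) ->
  leb2.-integrable setT (EFin \o (fun x => h x * k x)).
Proof.
move=> ih mk k1; have mh : measurable_fun setT h.
  by apply/measurable_EFinP; exact: measurable_int ih.
apply: (le_integrable _ _ _ ih) => //.
  by apply/measurable_EFinP; exact: measurable_funM.
by move=> x _; rewrite /= lee_fin normrM ler_piMr.
Qed.

Definition cos_transform (a : plane -> R) t x : R :=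
  \int[leb2]_w (a w * cos (x.1 * w.1 + x.2 * w.2 + t)).

Lemma cos_transform_integrable (a : plane -> R) t x : leb2.-integrable setT (EFin \o a) ->
  leb2.-integrable (setT : set plane)
    (EFin \o (fun w => a w * cos (x.1 * w.1 + x.2 * w.2 + t))).
Proof.
move=> ia; apply: integrable_cos_mul => //; first exact: plane_wave_measurable.
by move=> w; exact: cos_max.
Qed.

Lemma integral_scale (h : plane -> R) (c : R) : leb2.-integrable setT (EFin \o h) ->
  (\int[leb2]_w (c * h w)%:E)%E = (c * \int[leb2]_w h w)%:E.
Proof.
move=> ih; under eq_integral do rewrite EFinM.
rewrite integralZl// EFinM; congr (_ * _)%E.
by rewrite /Rintegral fineK//; exact: integrable_fin_num.
Qed.

Lemma chi_wave_integrable (a b t : R) : leb2.-integrable (setT : set plane)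
  (EFin \o (fun x => chi x * cos (a * x.1 + b * x.2 + t))).
Proof.
have := wave_density_integrable a b t; apply: eq_integrable => // x _.
by rewrite /wave_density patchE /= indicE; case: ifP => _; rewrite ?mul1r ?mul0r.
Qed.

Section Exchange.
Variables (a : plane -> R) (t : R).
Hypothesis ia : leb2.-integrable setT (EFin \o a).

Let kern (u : plane * plane) : \bar R :=
  (chi u.1 * (a u.2 * cos (u.1.1 * u.2.1 + u.1.2 * u.2.2 + t)))%:E.

(** The kernel is dominated by the indicator of the body times |a|, a product of two integrable
    functions of separate variables; this justifies Fubini in [wave_exchange]. *)
Lemma kern_integrable :
  (@plane_measure R \x @plane_measure R)%E.-integrable setT kern.
Proof.
have ma : measurable_fun (setT : set plane) a.
  by apply/measurable_EFinP; exact: measurable_int ia.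
have mk : measurable_fun setT kern.
  apply/measurable_EFinP; apply: measurable_funM.
    apply: (@measurableT_comp _ _ _ _ plane _ (chi : plane -> R)).
      by apply: measurable_indic; exact: body_measurable.
    exact: measurable_fst.
  apply: measurable_funM; first exact: (measurableT_comp ma measurable_snd).
  apply: (@measurableT_comp _ _ _ _ _ _ (@cos R)).
    by apply: continuous_measurable_fun; exact: continuous_cos.
  apply: measurable_funD => //; apply: measurable_funD; apply: measurable_funM.
  - exact: (measurableT_comp measurable_fst measurable_fst).
  - exact: (measurableT_comp measurable_fst measurable_snd).
  - exact: (measurableT_comp measurable_snd measurable_fst).
  - exact: (measurableT_comp measurable_snd measurable_snd).
apply/(@integrable12ltyP _ _ _ _ R (@plane_measure R) (@plane_measure R) _ mk).
have [_ aoo] := integrableP _ _ _ ia.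
pose A := \int[leb2]_w `|a w|.
have AE : (\int[leb2]_w `|(a w)%:E|)%E = A%:E.
  rewrite /A /Rintegral fineK// ge0_fin_numE//; exact: integral_ge0.
have A0 : 0 <= A by exact: Rintegral_ge0.
have mak : measurable_fun setT (abse \o kern) by exact: measurableT_comp.
have ak0 u : (0 <= (abse \o kern) u)%E by exact: abse_ge0.
have mc : measurable_fun (setT : set plane) (fun x => (chi x)%:E).
  by apply/measurable_EFinP; apply: measurable_indic; exact: body_measurable.
apply: (@le_lt_trans _ _ (\int[@plane_measure R]_x (A%:E * (chi x)%:E))%E).
  apply: ge0_le_integral => //.
  - by move=> x _; apply: integral_ge0.
  - exact: (measurable_fun_fubini_tonelli_F (m2 := @plane_measure R) _ mak ak0).
  - exact: measurable_funeM.
  move=> x _; rewrite muleC -AE.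
  rewrite -ge0_integralZl//; last by apply: measurableT_comp => //; exact/measurable_EFinP.
  apply: ge0_le_integral => //.
  - apply: measurableT_comp => //.
    exact: (measurable_fun_pair2 x mk).
  - by apply: measurable_funeM; apply: measurableT_comp => //; exact/measurable_EFinP.
  move=> w _; rewrite /kern /= -EFinM lee_fin normrM ger0_norm//.
  by rewrite ler_wpM2l// normrM ler_piMr// cos_max.
rewrite ge0_integralZl//.
rewrite integral_indic//; last exact: body_measurable.
rewrite setIT; apply: lte_mul_pinfty => //.
by apply: le_lt_trans body_measure_le _; rewrite ltry.
Qed.

Lemma chi_cos_transform_integrable :
  leb2.-integrable (setT : set plane) (EFin \o (fun x => chi x * cos_transform a t x)).
Proof.
have := @integrable_fubini_F _ _ _ _ R (@plane_measure R) (@plane_measure R) _ kern_integrable.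
apply: eq_integrable => // x _; rewrite /fubini_F /kern /=.
exact: (integral_scale _ (cos_transform_integrable t x ia)).
Qed.

Let kern_swap w :
  (\int[leb2]_x kern (x, w))%E = (a w * wave w.1 w.2 t)%:E.
Proof.
rewrite /wave -Rintegral_chi -(integral_scale _ (chi_wave_integrable _ _ _)).
apply: eq_integral => x _; rewrite /kern /= mulrCA.
by rewrite (mulrC x.1) (mulrC x.2).
Qed.

Lemma wave_mul_integrable :
  leb2.-integrable (setT : set plane) (EFin \o (fun w => a w * wave w.1 w.2 t)).
Proof.
have i4 : leb2.-integrable (setT : set plane)
    (EFin \o (fun w => a w * (wave w.1 w.2 t / 4))).
  apply: integrable_cos_mul => //.
    by apply: measurable_funM => //; exact: wave_measurable.
  move=> w; rewrite normrM normfV normr_nat ler_pdivrMr ?ltr0n// mul1r; exact: wave_le4.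
have := integrableZl measurableT 4 i4; apply: eq_integrable => // w _.
by rewrite /= -EFinM; congr EFin; field.
Qed.

Lemma wave_exchange :
  \int[leb2]_x (chi x * cos_transform a t x) = \int[leb2]_w (a w * wave w.1 w.2 t).
Proof.
have F := @Fubini _ _ _ _ R (@plane_measure R) (@plane_measure R) _ kern_integrable.
apply: (congr1 fine).
transitivity (\int[@plane_measure R]_x \int[@plane_measure R]_y kern (x, y))%E.
  apply: eq_integral => x _; rewrite /kern /=; symmetry.
  exact: (integral_scale _ (cos_transform_integrable t x ia)).
rewrite F; apply: eq_integral => w _; exact: kern_swap.
Qed.

End Exchange.

Lemma chi_integrable (h : plane -> R) : leb2.-integrable (setT : set plane) (EFin \o h) ->
  leb2.-integrable (setT : set plane) (EFin \o (fun x => chi x * h x)).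
Proof.
move=> ih; under [X in EFin \o X]eq_fun do rewrite mulrC.
apply: integrable_cos_mul => //.
  by apply: measurable_indic; exact: body_measurable.
by move=> x; rewrite indicE; case: (_ \in _); rewrite ?normr1 ?normr0.
Qed.

Lemma integral_comb (h k : plane -> R) (c d : R) :
  leb2.-integrable (setT : set plane) (EFin \o h) ->
  leb2.-integrable (setT : set plane) (EFin \o k) ->
  \int[leb2]_x (c * h x + d * k x) = c * \int[leb2]_x h x + d * \int[leb2]_x k x /\
  leb2.-integrable (setT : set plane) (EFin \o (fun x => c * h x + d * k x)).
Proof.
move=> ih ik.
have ich : leb2.-integrable (setT : set plane) (EFin \o (fun x => c * h x)).
  by have := integrableZl measurableT c ih; apply: eq_integrable.
have idk : leb2.-integrable (setT : set plane) (EFin \o (fun x => d * k x)).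
  by have := integrableZl measurableT d ik; apply: eq_integrable.
split; first by rewrite RintegralD// !RintegralZl.
by have := integrableD measurableT ich idk; apply: eq_integrable.
Qed.

Lemma regular_chi phi :
  regular (cindic (@body R)) phi =
  \int[leb2]_x (chi x * (ReC \o phi) x) +i* \int[leb2]_x (chi x * (ImC \o phi) x).
Proof.
rewrite /regular /cintegral; congr (_ +i* _); apply: eq_Rintegral => x _ /=.
  exact: Re_cindic.
exact: Im_cindic.
Qed.

Lemma tempered_body : tempered (regular (cindic (@body R))).
Proof.
split=> [c phi psi sphi spsi|].
  rewrite !regular_chi; case: c => c d.
  have ir := chi_integrable (schwartz_Re_integrable sphi).
  have ii := chi_integrable (schwartz_Im_integrable sphi).
  have jr := chi_integrable (schwartz_Re_integrable spsi).
  have ji := chi_integrable (schwartz_Im_integrable spsi).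
  have [e1 i1] := integral_comb c (- d) ir ii.
  have [e2 i2] := integral_comb c d ii ir.
  have [e3 _] := integral_comb 1 1 i1 jr.
  have [e4 _] := integral_comb 1 1 i2 ji.
  rewrite !mul1r e1 in e3; rewrite !mul1r e2 in e4.
  apply/eqP; rewrite eq_complex /=; apply/andP; split; apply/eqP.
    rewrite -[RHS]/(c * _ - d * _ + _) -mulNr -e3; apply: eq_Rintegral => x _ /=.
    by case: (phi x) => u v; case: (psi x) => u' v' /=; ring.
  rewrite -[RHS]/(c * _ + d * _ + _) -e4; apply: eq_Rintegral => x _ /=.
  by case: (phi x) => u v; case: (psi x) => u' v' /=; ring.
(* No weight is required on a bounded set: the real and imaginary parts are each at most the area
   bound 4 times the supremum of phi. *)
exists 0, 8 => phi sphi.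
have [M HM] := schwartz_decay 0 sphi.
have Mb x : absC (phi x) <= M by have [] := HM x; rewrite expr0 mul1r.
have M0 : 0 <= M by apply: le_trans (Mb 0); exact: normc_ge0.
apply: (@le_trans _ _ (8 * M)%:E); last first.
  by rewrite EFinM; apply: lee_wpmul2l; [rewrite lee_fin|have [] := HM 0].
rewrite lee_fin regular_chi; apply: le_trans (normc_le _) _.
have bd (h : plane -> R) : continuous (h : R * R -> R) -> (forall x, `|h x| <= M) ->
    `|\int[leb2]_x (chi x * h x)| <= 4 * M.
  move=> ch hM; rewrite Rintegral_chi.
  have mh : measurable_fun (setT : set plane) h by exact: continuous_plane_measurable.
  have ih := integrable_body mh hM.
  apply: le_trans (le_normr_Rintegral body_measurable ih) _.
  apply: (@le_trans _ _ (\int[leb2]_(x in (@body R : set plane)) M)).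
    apply: le_Rintegral.
    - exact: body_measurable.
    - exact: integrable_norm ih.
    - by apply: (@integrable_body _ (fun=> M) M) => // z; rewrite ger0_norm.
    - by move=> x _; exact: hM.
  rewrite Rintegral_cst; last exact: body_measurable.
  rewrite mulrC ler_wpM2r//.
  have h4 : fine (leb2 (@body R : set plane)) <= 4.
    by have := @body_measure_le R; case: (leb2 (@body R : set plane)) => [r||] //=.
  exact: h4.
have [c1 c2] := schwartz_continuous sphi.
have := bd (ReC \o phi) c1 (fun x => le_trans (Re_le_normc _) (Mb x)).
have := bd (ImC \o phi) c2 (fun x => le_trans (Im_le_normc _) (Mb x)).
by rewrite /=; lra.
Qed.

Lemma fourier_cos_transform phi x : schwartz phi -> fourier phi x =
  (cos_transform (ReC \o phi) 0 x - cos_transform (ImC \o phi) (pi / 2) x) +i*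
  (cos_transform (ReC \o phi) (pi / 2) x + cos_transform (ImC \o phi) 0 x).
Proof.
move=> sphi; have ir := schwartz_Re_integrable sphi; have ii := schwartz_Im_integrable sphi.
have [e1 _] := integral_comb 1 (-1) (cos_transform_integrable 0 x ir)
  (cos_transform_integrable (pi / 2) x ii).
have [e2 _] := integral_comb 1 1 (cos_transform_integrable (pi / 2) x ir)
  (cos_transform_integrable 0 x ii).
rewrite /fourier /cintegral; congr (_ +i* _).
  rewrite mul1r mulN1r in e1; rewrite -e1; apply: eq_Rintegral => w _ /=.
  by case: (phi w) => u v /=; rewrite cosDpihalf addr0 cosN sinN; ring.
rewrite !mul1r in e2; rewrite -e2; apply: eq_Rintegral => w _ /=.
by case: (phi w) => u v /=; rewrite cosDpihalf addr0 cosN sinN; ring.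
Qed.

(** The multiplication formula: the transform moves from phi to the indicator by Fubini, carried out
    for the four real integrals into which real and imaginary parts split the product. *)
Lemma dfourier_body phi : schwartz phi ->
  dfourier (regular (cindic (@body R))) phi = regular (fourier (cindic (@body R))) phi.
Proof.
move=> sphi; have ir := schwartz_Re_integrable sphi; have ii := schwartz_Im_integrable sphi.
rewrite /dfourier regular_chi.
have FRE x : (ReC \o fourier phi) x =
    cos_transform (ReC \o phi) 0 x - cos_transform (ImC \o phi) (pi / 2) x.
  exact: (congr1 ReC (fourier_cos_transform x sphi)).
have FIM x : (ImC \o fourier phi) x =
    cos_transform (ReC \o phi) (pi / 2) x + cos_transform (ImC \o phi) 0 x.
  exact: (congr1 ImC (fourier_cos_transform x sphi)).
have BE w := congr1 (fun z => z * phi w) (fourier_body w).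
have [e1 _] := integral_comb 1 (-1) (chi_cos_transform_integrable 0 ir)
  (chi_cos_transform_integrable (pi / 2) ii).
have [e2 _] := integral_comb 1 1 (chi_cos_transform_integrable (pi / 2) ir)
  (chi_cos_transform_integrable 0 ii).
have [f1 _] := integral_comb 1 (-1) (wave_mul_integrable 0 ir) (wave_mul_integrable (pi / 2) ii).
have [f2 _] := integral_comb 1 1 (wave_mul_integrable (pi / 2) ir) (wave_mul_integrable 0 ii).
rewrite /regular /cintegral; congr (_ +i* _).
  transitivity (\int[leb2]_w (1 * ((ReC \o phi) w * wave w.1 w.2 0) +
      -1 * ((ImC \o phi) w * wave w.1 w.2 (pi / 2)))).
    rewrite f1 -(wave_exchange 0 ir) -(wave_exchange (pi / 2) ii) -e1.
    apply: eq_Rintegral => x _; rewrite FRE; ring.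
  apply: eq_Rintegral => w _; apply: etrans; last exact/esym/(congr1 ReC (BE w)).
  by rewrite /=; case: (phi w) => u v /=; ring.
transitivity (\int[leb2]_w (1 * ((ReC \o phi) w * wave w.1 w.2 (pi / 2)) +
    1 * ((ImC \o phi) w * wave w.1 w.2 0))).
  rewrite f2 -(wave_exchange (pi / 2) ir) -(wave_exchange 0 ii) -e2.
  apply: eq_Rintegral => x _; rewrite FIM; ring.
apply: eq_Rintegral => w _; apply: etrans; last exact/esym/(congr1 ImC (BE w)).
by rewrite /=; case: (phi w) => u v /=; ring.
Qed.

End Tempered.

Theorem corollary4 (R : realType) :
  exists D : set (R * R),
    [/\ domain D, bounded_set D, C1_boundary D,
        (forall p : \bar R, (1 < p)%E -> in_A p (regular (cindic D))) &
        ~ contains_segment (boundary D)].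
Proof.
exists body; split.
- exact: body_domain.
- exact: body_bounded.
- exact: body_C1_boundary.
- move=> p p1; split; first exact: tempered_body.
  exists (fourier (cindic body)); split; first exact: fourier_body_Lp.
  exact: dfourier_body.
- exact: body_no_segment.
Qed.
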